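(* Let $a_n=1/(100n^3)$ for $n\in\mathbb{N}^*=\{1,2,3,\dots\}$ and let $N=4$. Let $T:[0,1)\to[0,1)$ be the map constructed from $(a_n)_{n\ge 1}$ and $N$ as in the context, and let $\mathcal{L}$ be its transfer operator with respect to Lebesgue measure. Then $T$ preserves Lebesgue measure, and $\mathcal{L}$ has a spectral gap on the space $\mathrm{Lip}$ of Lipschitz functions on $[0,1)$, with a simple eigenvalue at $1$ and no other eigenvalue of modulus $1$. On the other hand, $\mathcal{L}$ does not act continuously on the space $\mathcal{BV}$ of bounded variation functions on $[0,1)$ (that is, $\mathcal{L}$ does not define a bounded linear operator from $\mathcal{BV}$ to $\mathcal{BV}$).
   Context: Construction of $T$. Let $(a_n)_{n\ge1}$ be a sequence of positive reals with $\sum_{n\ge1} a_n<1/4$, and let $N>0$ be an integer. For $n\ge1$ let $I_n=\left[4\sum_{k=1}^{n-1}a_k,\;4\sum_{k=1}^{n}a_k\right)$, an interval of length $4a_n$. Decompose $I_n$ into two disjoint subintervals (closed on the left, open on the right) of length $2a_n$, denoted $I_n^{(1)}$ and $I_n^{(2)}$. Let $v_n$ and $w_n$ be the increasing $C^1$ maps on $[0,1)$ with respective images $I_n^{(1)}$ and $I_n^{(2)}$ and derivatives $v_n'(x)=a_n(1+2\cos^2(2\pi n^4x))$ and $w_n'(x)=a_n(1+2\sin^2(2\pi n^4x))$; these exist since both derivatives have integral $2a_n$ over $[0,1]$. Define $T$ on $I_n$ by requiring that $v_n$ and $w_n$ are inverse branches of $T$, i.e. $T(v_n(x))=x$ and $T(w_n(x))=x$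 for all $x\in[0,1)$. Let $J=\left[4\sum_{n=1}^\infty a_n,\,1\right)$, cut $J$ into $N$ subintervals (closed on the left, open on the right) of equal length, and let $T$ send each of them affinely onto $[0,1)$. Transfer operator. $\mathcal{L}$ is defined by duality by $\int f\cdot (g\circ T)\,d\mathrm{Leb}=\int (\mathcal{L}f)\cdot g\,d\mathrm{Leb}$; explicitly $\mathcal{L}f(x)=\sum_{T(y)=x}f(y)/T'(y)$, i.e. $\mathcal{L}f(x)=\sum_{u}u'(x)f(u(x))$ where $u$ runs over all inverse branches of $T$ (the maps $v_n,w_n$ for $n\ge 1$, and the $N$ affine inverse branches with image in $J$). Function spaces. Functions are complex-valued. For $f$ on $[0,1)$, $\|f\|_{\mathrm{Lip}}=\sup|f|+\mathrm{Lip}(f)$ with $\mathrm{Lip}(f)=\sup_{x\ne y}|f(x)-f(y)|/|x-y|$, and $\mathrm{Lip}$ is the Banach space of functions with $\|f\|_{\mathrm{Lip}}<\infty$. $\mathcal{BV}$ carries its usual norm, $\sup|f|$ plus the total variation of $f$ on $[0,1)$. Spectral gap. The statement that $\mathcal{L}$ has a spectral gap on $\mathrm{Lip}$, with a simple eigenvalue at $1$ and no other eigenvalue of modulus $1$, means that $\mathcal{L}$ is bounded on $\mathrm{Lip}$, its essential spectral radius there is $<1$, $1$ is an eigenvalue of algebraic multiplicity one, and there is no other eigenvalue of modulus $1$; thus the spectrum is $\{1\}$ together with a subset of a disk $\{|z|\le r\}$ for some $r<1$. *)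

(* Defs.v *)
From mathcomp Require Import all_boot all_order all_algebra.
From mathcomp Require Import all_classical all_reals all_analysis.
From mathcomp Require Import complex.

Set Implicit Arguments.
Unset Strict Implicit.
Unset Printing Implicit Defensive.

Import Order.TTheory GRing.Theory Num.Theory.
Import numFieldNormedType.Exports.

Local Open Scope classical_set_scope.
Local Open Scope ring_scope.

Definition modulus (R : realType) (z : R[i]) : R := Normc.normc z.

(** * The map T

    The sequence [a] is indexed from 1: the value [a 0] is never used, and
    [n] below is always meant to be at least 1. *)

Definition total_length (R : realType) (a : nat -> R) : R :=
  4 * limn (fun n => \sum_(1 <= k < n) a k).

Definition left_end (R : realType) (a : nat -> R) (n : nat) : R :=
  4 * \sum_(1 <= k < n) a k.

Definition dv (R : realType) (a : nat -> R) (n : nat) (x : R) : R :=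
  a n * (1 + 2 * cos (2 * pi * n%:R ^+ 4 * x) ^+ 2).

Definition dw (R : realType) (a : nat -> R) (n : nat) (x : R) : R :=
  a n * (1 + 2 * sin (2 * pi * n%:R ^+ 4 * x) ^+ 2).

(* [dv] and [dw] have integral [2 * a n] over [0, 1], so that the image of
   [0, 1) under [v n] (resp. [w n]) is the left (resp. right) half of
   I_n = [left_end a n, left_end a n + 4 * a n). *)
Definition v (R : realType) (a : nat -> R) (n : nat) (x : R) : R :=
  left_end a n + \int[lebesgue_measure]_(t in `[0, x]) dv a n t.

Definition w (R : realType) (a : nat -> R) (n : nat) (x : R) : R :=
  left_end a n + 2 * a n + \int[lebesgue_measure]_(t in `[0, x]) dw a n t.

Definition daff (R : realType) (a : nat -> R) (N : nat) : R :=
  (1 - total_length a) / N%:R.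

(* The image of [0, 1) is the k-th of the N pieces of [total_length a, 1). *)
Definition aff (R : realType) (a : nat -> R) (N k : nat) (x : R) : R :=
  total_length a + (k%:R + x) * daff a N.

(* [y] is the image of [x] under some inverse branch. *)
Definition on_branch (R : realType) (a : nat -> R) (N : nat) (y x : R) : Prop :=
  (exists2 n, (0 < n)%N & y = v a n x \/ y = w a n x) \/
  (exists2 k, (k < N)%N & y = aff a N k x).

(* The images of [0, 1) under the inverse branches partition [0, 1), so for
   y in [0, 1) the point chosen by [xget] is the only candidate; the default
   value 0 only matters for y outside [0, 1). *)
Definition T (R : realType) (a : nat -> R) (N : nat) (y : R) : R :=
  xget 0 [set x | 0 <= x < 1 /\ on_branch a N y x].

Definition preserves_lebesgue (R : realType) (S : R -> R) : Prop :=
  measurable_fun `[(0 : R), 1[ S /\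
  forall A : set R, measurable A -> A `<=` `[(0 : R), 1[ ->
    lebesgue_measure (`[(0 : R), 1[ `&` S @^-1` A) = lebesgue_measure A.

(** * The transfer operator

    A complex-valued function on [0, 1) is represented by its extension by 0
    to all of R, so that equality of functions on [0, 1) is plain equality. *)

Definition cfun (R : realType) := R -> R[i]^o.

Definition supported (R : realType) (f : cfun R) : Prop :=
  forall x, ~~ (0 <= x < 1) -> f x = 0.

Definition transfer (R : realType) (a : nat -> R) (N : nat) (f : cfun R) :
    cfun R :=
  fun x => if 0 <= x < 1 then
    limn (fun m => \sum_(1 <= n < m)
      ((dv a n x)%:C%C *: f (v a n x) + (dw a n x)%:C%C *: f (w a n x)))
    + \sum_(k < N) (daff a N)%:C%C *: f (aff a N k x)
  else 0.

(** * The spaces Lip and BV *)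

Definition sup_norm (R : realType) (f : cfun R) : \bar R :=
  ereal_sup [set (modulus (f x))%:E | x in `[(0 : R), 1[].

Definition lip_const (R : realType) (f : cfun R) : \bar R :=
  ereal_sup [set l | exists x y : R, [/\ 0 <= x < 1, 0 <= y < 1, x != y
    & l = (modulus (f x - f y) / `|x - y|)%:E]].

Definition lip_norm (R : realType) (f : cfun R) : \bar R :=
  (sup_norm f + lip_const f)%E.

Definition Lip (R : realType) : set (cfun R) :=
  [set f | supported f /\ (lip_norm f < +oo)%E].

Definition total_var (R : realType) (f : cfun R) : \bar R :=
  ereal_sup [set l | exists s : seq R,
    [/\ sorted <%R s, all (fun x => 0 <= x < 1) s
      & l = (\sum_(i < (size s).-1) modulus (f s`_i.+1 - f s`_i))%:E]].

Definition bv_norm (R : realType) (f : cfun R) : \bar R :=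
  (sup_norm f + total_var f)%E.

Definition BV (R : realType) : set (cfun R) :=
  [set f | supported f /\ (bv_norm f < +oo)%E].

(** * Spectral theory

    A Banach space is given by a subspace [X] of an ambient complex vector
    space [V] together with a norm [nrm], finite on [X]. *)

Definition bounded_operator (R : realType) (V : lmodType R[i]) (X : set V)
    (nrm : V -> \bar R) (A : V -> V) : Prop :=
  [/\ forall f, X f -> X (A f),
      forall c f g, X f -> X g -> A (c *: f + g) = c *: A f + A g
    & exists M : R, forall f, X f -> (nrm (A f) <= M%:E * nrm f)%E].

Definition shift_op (R : realType) (V : lmodType R[i]) (A : V -> V) (z : R[i])
    (f : V) : V := A f - z *: f.

Definition spectrum (R : realType) (V : lmodType R[i]) (X : set V)
    (nrm : V -> \bar R) (A : V -> V) : set R[i] :=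
  [set z | ~ exists B : V -> V, bounded_operator X nrm B /\
    forall f, X f -> B (shift_op A z f) = f /\ shift_op A z (B f) = f].

Definition eigenvalue (R : realType) (V : lmodType R[i]) (X : set V)
    (A : V -> V) (z : R[i]) : Prop :=
  exists f, [/\ X f, f != 0 & A f = z *: f].

Definition has_dim (R : realType) (V : lmodType R[i]) (E : set V) (n : nat) :
    Prop :=
  exists e : 'I_n -> V,
    [/\ forall i, E (e i),
        forall c : 'I_n -> R[i],
          \sum_(i < n) c i *: e i = 0 -> forall i, c i = 0
      & forall f, E f -> exists c : 'I_n -> R[i], f = \sum_(i < n) c i *: e i].

Definition generalized_eigenspace (R : realType) (V : lmodType R[i])
    (X : set V) (A : V -> V) (z : R[i]) : set V :=
  [set f | X f /\ exists k, iter k (shift_op A z) f = 0].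

Definition algebraic_multiplicity (R : realType) (V : lmodType R[i])
    (X : set V) (A : V -> V) (z : R[i]) (n : nat) : Prop :=
  has_dim (generalized_eigenspace X A z) n.

(* Finite-dimensional kernel and finite-codimensional range; for a bounded
   operator on a Banach space the range is then automatically closed. *)
Definition fredholm (R : realType) (V : lmodType R[i]) (X : set V)
    (A : V -> V) : Prop :=
  (exists n, has_dim [set f | X f /\ A f = 0] n) /\
  (exists n (e : 'I_n -> V), (forall i, X (e i)) /\
    forall f, X f -> exists g (c : 'I_n -> R[i]),
      X g /\ f = A g + \sum_(i < n) c i *: e i).

Definition essential_spectrum (R : realType) (V : lmodType R[i]) (X : set V)
    (A : V -> V) : set R[i] :=
  [set z | ~ fredholm X (shift_op A z)].

Definition essential_spectral_radius (R : realType) (V : lmodType R[i])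
    (X : set V) (A : V -> V) : \bar R :=
  ereal_sup [set (modulus z)%:E | z in essential_spectrum X A].

(* The last clause follows from the previous ones. *)
Definition spectral_gap_at_1 (R : realType) (V : lmodType R[i]) (X : set V)
    (nrm : V -> \bar R) (A : V -> V) : Prop :=
  [/\ bounded_operator X nrm A,
      (essential_spectral_radius X A < 1)%E,
      eigenvalue X A 1 /\ algebraic_multiplicity X A 1 1,
      forall z, eigenvalue X A z -> modulus z = 1 -> z = 1
    & exists (r : R) (D : set R[i]), [/\ r < 1,
        D `<=` [set z | modulus z <= r]
      & spectrum X nrm A = [set 1] `|` D]].

(* Main.v *)
(** On each slot I_n the two weights v_n' and w_n' oscillate wildly but have the
    constant sum 4 a_n. In L f(x) - L f(y) their variation is therefore only
    multiplied by f(v_n y) - f(w_n y) = O(a_n Lip f), and since the sum of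
    n^4 a_n^2 is small the seminorm Lip is contracted: Lip(L f) <= rho Lip(f)
    with rho = 1/50 + 1/N < 1. As L 1 = 1 and L does not increase the sup norm,
    L^n f converges to a constant m(f); on the kernel of m the Neumann series of
    L - z converges for |z| > rho, so L - z is invertible there, except for the
    eigenvalue 1 carried by the constants. In BV no such cancellation occurs:
    the image under L of the indicator of I_n^(1) is v_n', of variation about
    8 n^4 a_n. For the invariance of Lebesgue measure, the preimage of [0, t) is
    a countable union of intervals whose lengths sum to t. *)
Require Import Defs.
From mathcomp Require Import all_boot all_order all_algebra.
From mathcomp Require Import all_classical all_reals all_analysis.
From mathcomp Require Import complex.
From mathcomp Require Import measurable_realfun ring lra.
Import Order.TTheory GRing.Theory Num.Theory.
Import numFieldNormedType.Exports.
Local Open Scope classical_set_scope.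
Local Open Scope ring_scope.

Set Implicit Arguments.
Unset Strict Implicit.
Unset Printing Implicit Defensive.

(** * Complex sequences and series *)

Section ComplexModulus.
Variable R : realType.
Implicit Types (z w : R[i]) (x y : R).

(** The exponents separate the two spaces: with frequencies of order n^4 and a_n of order n^-3, the
    products n^4 a_n^2 are of order n^-2, hence summable, while n^4 a_n is of order n, hence
    unbounded. A spectral gap usually comes from a two-norm inequality and a compactness argument.
    Here the seminorm contracts with no additional sup-norm term, so the resolvent can be written
    down and no compactness enters. The spectral half therefore treats an arbitrary linear operator
    that fixes the constants, preserves sup bounds and multiplies Lipschitz constants by rho;
    nothing about T is involved. The functional m is invariant under the operator: this turns decay
    of the seminorm into decay of the sup norm on the kernel of m, and it also excludes a Jordan
    block at 1. The identity v_n' + w_n' = 4 a_n serves a second time for the invariance of Lebesgue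
    measure: the oscillating parts of v_n and w_n are opposite, so the lengths of the preimages of
    [0, t) carry no trigonometric remainder. *)

Lemma modulusE z : (modulus z)%:C%C = `|z|.
Proof. by case: z => a b; rewrite normc_def. Qed.

Lemma modulusM z w : modulus (z * w) = modulus z * modulus w.
Proof. exact: Normc.normcM. Qed.

Lemma modulusN z : modulus (- z) = modulus z.
Proof. exact: normcN. Qed.

Lemma modulus0 : modulus (0 : R[i]) = 0.
Proof. exact: Normc.normc0. Qed.

Lemma modulus1 : modulus (1 : R[i]) = 1.
Proof. exact: Normc.normc1. Qed.

Lemma modulus_ge0 z : 0 <= modulus z.
Proof. by case: z => a b; rewrite /modulus sqrtr_ge0. Qed.

Lemma modulus_eq0 z : (modulus z == 0) = (z == 0).
Proof. by apply/eqP/eqP => [/Normc.eq0_normc//|->]; rewrite modulus0. Qed.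

Lemma ler_modulusD z w : modulus (z + w) <= modulus z + modulus w.
Proof. exact: le_normcD. Qed.

Lemma ler_modulusB z w : modulus (z - w) <= modulus z + modulus w.
Proof. by rewrite -(modulusN w) ler_modulusD. Qed.

Lemma modulus_real x : modulus x%:C%C = `|x|.
Proof. by rewrite /modulus /= expr0n/= addr0 sqrtr_sqr. Qed.

Lemma modulus_realB x y : modulus (x%:C%C - y%:C%C) = `|x - y|.
Proof. by rewrite -modulus_real rmorphB. Qed.

Lemma modulusX z n : modulus (z ^+ n) = modulus z ^+ n.
Proof.
by elim: n => [|n IH]; rewrite ?expr0 ?modulus1// !exprS modulusM IH.
Qed.

Lemma modulusV z : modulus z^-1 = (modulus z)^-1.
Proof. exact: Normc.normcV. Qed.

Lemma ler_modulus_sum (I : Type) (r : seq I) (P : pred I) (u : I -> R[i]) :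
  modulus (\sum_(i <- r | P i) u i) <= \sum_(i <- r | P i) modulus (u i).
Proof.
apply: (big_ind2 (fun z x => modulus z <= x)) => //; first by rewrite modulus0.
by move=> z x w y zx wy; rewrite (le_trans (ler_modulusD _ _))// lerD.
Qed.

Lemma ler_Re_modulus z : `|complex.Re z| <= modulus z.
Proof. by have := normc_ge_Re z; rewrite -modulusE lecR. Qed.

Lemma ler_Im_modulus z : `|complex.Im z| <= modulus z.
Proof.
have := ler_Re_modulus (z * 'i%C); rewrite ReiNIm normrN => /le_trans; apply.
by rewrite modulusM [X in _ * X](_ : _ = 1) ?mulr1// /modulus /= expr0n/= expr1n add0r sqrtr1.
Qed.

Lemma ler_modulus_Re_Im z : modulus z <= `|complex.Re z| + `|complex.Im z|.
Proof.
rewrite [X in modulus X]complexE (le_trans (ler_modulusD _ _))// modulusM.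
rewrite !modulus_real [X in X * _](_ : _ = 1) ?mul1r// /modulus /=.
by rewrite expr0n/= expr1n add0r sqrtr1.
Qed.

Lemma cvgn_modulusP (u : nat -> R[i]^o) (l : R[i]^o) :
  u n @[n --> \oo] --> l <->
  forall e, 0 < e -> \forall n \near \oo, modulus (l - u n) < e.
Proof.
split=> [/cvgrPdist_lt ul e e0|ul].
  have := ul e%:C%C; rewrite ltcR => /(_ e0); apply: filterS => n.
  by rewrite -modulusE ltcR.
apply/cvgrPdist_lt => e e0; have eE : e = (complex.Re e)%:C%C.
  by rewrite RRe_real// gtr0_real.
move: e0; rewrite eE ltcR => /ul; apply: filterS => n.
by rewrite -modulusE ltcR.
Qed.

Lemma ReB z w : complex.Re (z - w) = complex.Re z - complex.Re w.
Proof. by case: z; case: w. Qed.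

Lemma ImB z w : complex.Im (z - w) = complex.Im z - complex.Im w.
Proof. by case: z; case: w. Qed.

Lemma Re_sum (I : Type) (r : seq I) (P : pred I) (u : I -> R[i]) :
  complex.Re (\sum_(i <- r | P i) u i) = \sum_(i <- r | P i) complex.Re (u i).
Proof. by apply: (big_morph _ _ (erefl _)) => -[? ?] []. Qed.

Lemma Im_sum (I : Type) (r : seq I) (P : pred I) (u : I -> R[i]) :
  complex.Im (\sum_(i <- r | P i) u i) = \sum_(i <- r | P i) complex.Im (u i).
Proof. by apply: (big_morph _ _ (erefl _)) => -[? ?] []. Qed.

Lemma cvgn_Re_Im (u : nat -> R[i]^o) (a b : R) :
  complex.Re (u n) @[n --> \oo] --> a -> complex.Im (u n) @[n --> \oo] --> b ->
  u n @[n --> \oo] --> ((a +i* b)%C : R[i]^o).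
Proof.
move=> /cvgrPdist_lt ua /cvgrPdist_lt ub; apply/cvgn_modulusP => e e0.
have e2 : 0 < e / 2 by rewrite divr_gt0.
near=> n; rewrite (le_lt_trans (ler_modulus_Re_Im _))//.
rewrite [X in _ < X](splitr e) ltrD//.
  by rewrite ReB /=; near: n; exact: ua.
by rewrite ImB /=; near: n; exact: ub.
Unshelve. all: by end_near. Qed.

End ComplexModulus.

Section ComplexSeries.
Variable R : realType.
Implicit Types (u : nat -> R[i]^o) (b : nat -> R).

Lemma is_cvg_real_series_dominated (p : nat) (r b : nat -> R) (B : R) :
  (forall n, (p <= n)%N -> `|r n| <= b n) ->
  (forall m, \sum_(p <= n < m) b n <= B) ->
  cvgn (fun m => \sum_(p <= n < m) r n).
Proof.
(* Nothing is known of the terms below p, so they are replaced by 0 before absolute convergence is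
   invoked. *)
move=> rb bB; pose r' n := if (p <= n)%N then r n else 0.
have -> : (fun m => \sum_(p <= n < m) r n) = (fun m => \sum_(p <= n < m) r' n).
  by apply/funext => m; apply: eq_big_nat => n /andP[pn _]; rewrite /r' pn.
rewrite (is_cvg_series_restrict p r'); apply: normed_cvg.
apply: nondecreasing_is_cvgn.
  have : nondecreasing_seq (fun m => \sum_(0 <= k < m) `|r' k|).
    by apply: nondecreasing_series => n _ _.
  by apply.
exists B => _ [m _ <-]; rewrite [X in X <= _](_ : _ = \sum_(0 <= k < m) `|r' k|)//.
have [mp|/ltnW pm] := leqP m p.
  rewrite big_nat big1 => [|n /andP[_ nm]].
    by rewrite (le_trans _ (bB p))// big_geq.
  by rewrite /r' leqNgt (leq_trans nm mp) normr0.
rewrite (big_cat_nat (n := p))//= [X in X + _]big_nat big1 => [|n /andP[_ nm]]; last first.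
  by rewrite /r' leqNgt nm normr0.
rewrite add0r (le_trans _ (bB m))// !big_nat ler_sum// => n /andP[pn _].
by rewrite /r' pn rb.
Qed.

Lemma is_cvg_series_dominated (p : nat) u b (B : R) :
  (forall n, (p <= n)%N -> modulus (u n) <= b n) ->
  (forall m, \sum_(p <= n < m) b n <= B) ->
  cvgn (fun m => \sum_(p <= n < m) u n).
Proof.
move=> ub bB; pose re n := complex.Re (u n); pose im n := complex.Im (u n).
have cre : cvgn (fun m => \sum_(p <= n < m) re n).
  apply: (is_cvg_real_series_dominated (b := b) (B := B)) => // n pn.
  by rewrite (le_trans (ler_Re_modulus _)) ?ub.
have cim : cvgn (fun m => \sum_(p <= n < m) im n).
  apply: (is_cvg_real_series_dominated (b := b) (B := B)) => // n pn.
  by rewrite (le_trans (ler_Im_modulus _)) ?ub.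
apply/cvg_ex; eexists; apply: cvgn_Re_Im.
  by under eq_fun => m do rewrite Re_sum; exact: cre.
by under eq_fun => m do rewrite Im_sum; exact: cim.
Qed.

Lemma modulus_limn_le u (B : R) : cvgn u ->
  (\forall n \near \oo, modulus (u n) <= B) -> modulus (limn u) <= B.
Proof.
move=> /cvgn_modulusP ul uB; apply/ler_addgt0Pr => e e0.
have [n [uBn lun]] := @filter_ex _ _ _ _ (filterI uB (ul e e0)).
rewrite -(subrK (u n) (limn u)) (le_trans (ler_modulusD _ _))//.
by rewrite addrC lerD// ltW.
Qed.

Lemma modulus_limn_series_le (p : nat) u b (B : R) :
  (forall n, (p <= n)%N -> modulus (u n) <= b n) ->
  (forall m, \sum_(p <= n < m) b n <= B) ->
  modulus (limn (fun m => \sum_(p <= n < m) u n)) <= B.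
Proof.
move=> ub bB; apply: modulus_limn_le.
  exact: is_cvg_series_dominated ub bB.
apply: nearW => m; rewrite (le_trans (ler_modulus_sum _ _ _))// (le_trans _ (bB m))//.
by rewrite !big_nat ler_sum// => n /andP[pn _]; exact: ub.
Qed.

Lemma limn_real (r : nat -> R) (u : nat -> R[i]^o) :
  (forall n, u n = (r n)%:C%C) -> cvgn r -> limn u = (limn r)%:C%C.
Proof.
move=> ur /cvgrPdist_lt rl; apply/cvg_lim => //.
apply/cvgn_modulusP => e /rl; apply: filterS => n.
by rewrite ur modulus_realB.
Qed.

End ComplexSeries.

(** * Lipschitz functions on [0, 1) *)

Section LipBounds.
Variable R : realType.
Implicit Types (f g : cfun R) (B K : R).

(** Estimates are carried by real bounds, not necessarily optimal, instead of the extended-real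
    suprema; the norms come back through [lip_norm_le] and [Lip_bounds]. *)
Definition bounded_on01 f B := forall x, 0 <= x < 1 -> modulus (f x) <= B.

Definition lipschitz_on01 f K := forall x y, 0 <= x < 1 -> 0 <= y < 1 ->
  modulus (f x - f y) <= K * `|x - y|.

Lemma dist_on01 (x y : R) : 0 <= x < 1 -> 0 <= y < 1 -> `|x - y| <= 1.
Proof. by move=> ? ?; rewrite ler_norml; lra. Qed.

Lemma cfunDE f g x : (f + g) x = f x + g x. Proof. by []. Qed.

Lemma cfunZE (c : R[i]) f x : (c *: f) x = c * f x. Proof. by []. Qed.

Lemma cfunNE f x : (- f) x = - f x. Proof. by []. Qed.

Lemma bounded_on01_comb (c : R[i]) f g B B' :
  bounded_on01 f B -> bounded_on01 g B' ->
  bounded_on01 (c *: f + g) (modulus c * B + B').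
Proof.
move=> fB gB x x01; rewrite (le_trans (ler_modulusD _ _))// modulusM.
by rewrite lerD ?gB// ler_wpM2l ?modulus_ge0 ?fB.
Qed.

Lemma lipschitz_on01_comb (c : R[i]) f g K K' :
  lipschitz_on01 f K -> lipschitz_on01 g K' ->
  lipschitz_on01 (c *: f + g) (modulus c * K + K').
Proof.
move=> fK gK x y x01 y01.
have -> : (c *: f + g) x - (c *: f + g) y = c * (f x - f y) + (g x - g y).
  by rewrite !cfunDE !cfunZE; ring.
rewrite (le_trans (ler_modulusD _ _))// modulusM mulrDl.
by rewrite lerD ?gK// -mulrA ler_wpM2l ?modulus_ge0 ?fK.
Qed.

Lemma lip_norm_le f B K : bounded_on01 f B -> lipschitz_on01 f K ->
  (lip_norm f <= (B + K)%:E)%E.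
Proof.
move=> fB fK; rewrite EFinD leeD//; apply: ge_ereal_sup.
  by move=> _ [x + <-]; rewrite /= in_itv/= lee_fin => /fB.
move=> _ [x [y [x01 y01 xy ->]]]; rewrite lee_fin ler_pdivrMr ?fK//.
by rewrite normr_gt0 subr_eq0.
Qed.

Lemma LipI f B K : supported f -> bounded_on01 f B -> lipschitz_on01 f K ->
  Lip f.
Proof.
move=> sf fB fK; split => //.
by rewrite (le_lt_trans (lip_norm_le fB fK))// ltry.
Qed.

Lemma Lip_bounds f : Lip f -> exists B K, [/\ 0 <= B, 0 <= K,
  bounded_on01 f B, lipschitz_on01 f K & lip_norm f = (B + K)%:E].
Proof.
move=> [sf]; rewrite /lip_norm.
(* The points 0 and 1/2 show that both suprema are nonnegative, so finiteness of their sum makes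
   each of them finite. They are then the bounds B and K, which is why the norm equals B + K
   exactly. *)
have zero01 : 0 <= (0 : R) < 1 by rewrite lexx ltr01.
have half01 : 0 <= (2^-1 : R) < 1 by apply/andP; split; lra.
have Bub x : 0 <= x < 1 -> ((modulus (f x))%:E <= sup_norm f)%E.
  by move=> x01; apply: ereal_sup_ubound; exists x; rewrite //= in_itv.
have Kub x y : 0 <= x < 1 -> 0 <= y < 1 -> x != y ->
    ((modulus (f x - f y) / `|x - y|)%:E <= lip_const f)%E.
  by move=> *; apply: ereal_sup_ubound; exists x, y.
have B0 : (0 <= sup_norm f)%E.
  by rewrite (le_trans _ (Bub _ zero01))// lee_fin modulus_ge0.
have K0 : (0 <= lip_const f)%E.
  have ne : (0 : R) != 2^-1 by rewrite eq_sym invr_eq0 pnatr_eq0.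
  by rewrite (le_trans _ (Kub _ _ zero01 half01 ne))// lee_fin divr_ge0 ?modulus_ge0.
case: (sup_norm f) B0 Bub => [B||] B0 Bub //; last by case: (lip_const f) K0.
case: (lip_const f) K0 Kub => [K||] K0 Kub // _.
exists B, K; split => // x y x01 y01.
have [->|xy] := eqVneq x y; first by rewrite !subrr modulus0 normr0 mulr0.
by rewrite -ler_pdivrMr ?normr_gt0 ?subr_eq0// -lee_fin Kub.
Qed.

Lemma Lip_supported f : Lip f -> supported f. Proof. by case. Qed.

Lemma Lip_comb (c : R[i]) f g : Lip f -> Lip g -> Lip (c *: f + g).
Proof.
move=> Lf Lg; have [B [K [_ _ fB fK _]]] := Lip_bounds Lf.
have [B' [K' [_ _ gB gK _]]] := Lip_bounds Lg.
apply: (LipI _ (bounded_on01_comb c fB gB) (lipschitz_on01_comb c fK gK)).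
move=> x xN; rewrite cfunDE cfunZE (Lip_supported Lf)// (Lip_supported Lg)//.
by rewrite mulr0 addr0.
Qed.

Lemma Lip0 : Lip (0 : cfun R).
Proof.
by apply: (@LipI _ 0 0) => // [x _|x y _ _]; rewrite ?subr0 modulus0 ?mul0r.
Qed.

Definition one01 : cfun R := fun x => if 0 <= x < 1 then 1 else 0.

Lemma one01E x : 0 <= x < 1 -> one01 x = 1.
Proof. by rewrite /one01 => ->. Qed.

Lemma bounded_on01_one : bounded_on01 one01 1.
Proof. by move=> x x01; rewrite one01E// modulus1. Qed.

Lemma lipschitz_on01_one : lipschitz_on01 one01 0.
Proof. by move=> x y x01 y01; rewrite !one01E// subrr modulus0 mul0r. Qed.

Lemma Lip_one : Lip one01.
Proof.
apply: (LipI _ bounded_on01_one lipschitz_on01_one) => x.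
by rewrite /one01 => /negbTE->.
Qed.

Lemma one01_neq0 : one01 != 0.
Proof.
apply/eqP => /(congr1 (fun f => f 0)); rewrite one01E ?lexx ?ltr01//.
by move=> /eqP; rewrite oner_eq0.
Qed.

End LipBounds.

(** * Spectrum of an operator contracting the Lipschitz seminorm *)

Section LipschitzContraction.
Variable R : realType.
Variables (A : cfun R -> cfun R) (rho : R).
Implicit Types (f g : cfun R) (B K : R) (z : R[i]).

Local Notation one := (@one01 R).

Hypothesis rho_ge0 : 0 <= rho.
Hypothesis rho_lt1 : rho < 1.
Hypothesis A_supported : forall f, supported (A f).
Hypothesis A_linear :
  forall c f g, Lip f -> Lip g -> A (c *: f + g) = c *: A f + A g.
Hypothesis A_one : A one = one.
Hypothesis A_bounded :
  forall f B, Lip f -> bounded_on01 f B -> bounded_on01 (A f) B.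
Hypothesis A_contracts : forall f K, Lip f -> 0 <= K ->
  lipschitz_on01 f K -> lipschitz_on01 (A f) (rho * K).

Lemma A0 : A 0 = 0.
Proof.
have <- : - 1 *: one + one = 0 by rewrite scaleN1r addNr.
by rewrite A_linear; [rewrite A_one|exact: Lip_one..].
Qed.

Lemma Lip_A f : Lip f -> Lip (A f).
Proof.
move=> Lf; have [B [K [_ K0 fB fK _]]] := Lip_bounds Lf.
exact: LipI (A_bounded Lf fB) (A_contracts Lf K0 fK).
Qed.

Lemma Lip_iter f n : Lip f -> Lip (iter n A f).
Proof. by move=> Lf; elim: n => [|n IH] //=; exact: Lip_A. Qed.

Lemma iter_bounded f B n : Lip f -> bounded_on01 f B ->
  bounded_on01 (iter n A f) B.
Proof.
move=> Lf fB; elim: n => [|n IH] //=.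
by apply: A_bounded => //; exact: Lip_iter.
Qed.

Lemma iter_contracts f K n : Lip f -> 0 <= K -> lipschitz_on01 f K ->
  lipschitz_on01 (iter n A f) (rho ^+ n * K).
Proof.
move=> Lf K0 fK; elim: n => [|n IH] /=; first by rewrite mul1r.
rewrite exprS -mulrA; apply: A_contracts => //; first exact: Lip_iter.
by rewrite mulr_ge0 ?exprn_ge0.
Qed.

Lemma iter_comb_one (c : R[i]) f n : Lip f ->
  iter n A (c *: one + f) = c *: one + iter n A f.
Proof.
move=> Lf; elim: n => [|n IH] //=.
by rewrite IH A_linear ?A_one//; [exact: Lip_one|exact: Lip_iter].
Qed.

(** As [0, 1) has diameter at most 1, f minus the constant f y is bounded by K. The iterates of A
    keep this bound and fix the constant. *)
Lemma iter_dist f K n x y : Lip f -> 0 <= K -> lipschitz_on01 f K ->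
  0 <= x < 1 -> 0 <= y < 1 -> modulus (iter n A f x - f y) <= K.
Proof.
move=> Lf K0 fK x01 y01.
have fyB : bounded_on01 (- f y *: one + f) K.
  move=> t t01; rewrite cfunDE cfunZE one01E// mulr1 addrC.
  by rewrite (le_trans (fK _ _ t01 y01))// ler_piMr// dist_on01.
have Lg : Lip (- f y *: one + f) by apply: Lip_comb => //; exact: Lip_one.
have := iter_bounded n Lg fyB x01.
by rewrite iter_comb_one// cfunDE cfunZE one01E// mulr1 addrC.
Qed.

Lemma zero_on01 : 0 <= (0 : R) < 1. Proof. by rewrite lexx ltr01. Qed.

Lemma geometric_partial_sum_le (C q : R) (p m : nat) : 0 <= C -> 0 <= q < 1 ->
  \sum_(p <= n < m) C * q ^+ n <= C * q ^+ p / (1 - q).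
Proof.
move=> C0 /andP[q0 q1]; have q1' : 0 < 1 - q by rewrite subr_gt0.
have [mp|pm] := leqP m p.
  by rewrite big_geq// divr_ge0 ?mulr_ge0 ?exprn_ge0// ltW.
rewrite ler_pdivlMr// mulr_suml.
rewrite (eq_bigr (fun n => C * q ^+ n - C * q ^+ n.+1)) => [|n _]; last first.
  by rewrite exprS; ring.
rewrite (telescope_sumr_eq (fun n => - (C * q ^+ n))) ?(ltnW pm)//; last first.
  by move=> n _; ring.
by rewrite opprK addrC lerBlDr lerDl mulr_ge0 ?exprn_ge0.
Qed.

(** The tool for proving equalities below: t is the modulus of a difference, and n is free. *)
Lemma le0_geometric (t C q : R) : 0 <= q < 1 ->
  (forall n, t <= C * q ^+ n) -> t <= 0.
Proof.
move=> /andP[q0 q1] tq.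
have cq : (fun n => C * q ^+ n) @ \oo --> C * 0.
  by apply: cvgMr; apply: cvg_expr; rewrite ger0_norm.
rewrite -(mulr0 C) -(cvg_lim _ cq)//.
by apply: limr_ge; [exact: cvgP cq|exact: nearW].
Qed.

(** The functional m. The base point 0 is immaterial: [iter n A f] has Lipschitz constant at most
    rho^n K, so its values at any two points of [0, 1) have the same limit. *)
Definition limit_value f : R[i]^o := limn (fun n => iter n A f 0 : R[i]^o).

Lemma is_cvg_iter f : Lip f -> cvgn (fun n => iter n A f 0 : R[i]^o).
Proof.
move=> Lf; have [B [K [_ K0 fB fK _]]] := Lip_bounds Lf.
pose u n : R[i]^o := iter n.+1 A f 0 - iter n A f 0.
have cu : cvgn (fun m => \sum_(0 <= n < m) u n).
  apply: (@is_cvg_series_dominated _ _ _ (fun n => K * rho ^+ n)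
    (K * rho ^+ 0 / (1 - rho))) => [n _|m].
    (* The increment is one more application of A to [iter n A f], whose Lipschitz constant is rho^n
       K; hence a geometric majorant. *)
    rewrite /u mulrC; apply: (@iter_dist (iter n A f) _ 1); rewrite ?zero_on01//.
    - exact: Lip_iter.
    - by rewrite mulr_ge0 ?exprn_ge0.
    - exact: iter_contracts.
  by apply: geometric_partial_sum_le; rewrite ?rho_ge0.
have -> : (fun n => iter n A f 0 : R[i]^o) =
    (fun _ => f 0) + (fun m => \sum_(0 <= n < m) u n).
  apply/funext => n; transitivity (f 0 + \sum_(0 <= k < n) u k); last by [].
  rewrite (telescope_sumr_eq (fun k => iter k A f 0))//.
  by rewrite addrC subrK.
by apply: is_cvgD; [exact: is_cvg_cst|exact: cu].
Qed.

Lemma limit_value_dist f K x : Lip f -> 0 <= K -> lipschitz_on01 f K ->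
  0 <= x < 1 -> modulus (limit_value f - f x) <= K.
Proof.
move=> Lf K0 fK x01.
have cf := is_cvg_iter Lf; have cfx : cvgn (fun _ : nat => f x : R[i]^o) by exact: is_cvg_cst.
have -> : limit_value f - f x =
    limn ((fun n => iter n A f 0 : R[i]^o) - (fun _ => f x)).
  by rewrite (limB cf cfx) lim_cst.
apply: modulus_limn_le; first exact: is_cvgB cf cfx.
by apply: nearW => n; apply: iter_dist => //; exact: zero_on01.
Qed.

Lemma limit_value_comb_one (c : R[i]) f : Lip f ->
  limit_value (c *: one + f) = c + limit_value f.
Proof.
move=> Lf; have cf := is_cvg_iter Lf.
have -> : limit_value (c *: one + f) =
    limn ((fun _ => c : R[i]^o) + (fun n => iter n A f 0 : R[i]^o)).
  congr (limn _); apply/funext => n.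
  by rewrite iter_comb_one// cfunDE cfunZE one01E ?zero_on01// mulr1.
by rewrite (limD (is_cvg_cst (c : R[i]^o)) cf) lim_cst.
Qed.

Lemma limit_value_A f : Lip f -> limit_value (A f) = limit_value f.
Proof.
move=> Lf; apply/cvg_lim => //.
rewrite (_ : (fun n => _) = [sequence (iter (n + 1) A f 0 : R[i]^o)]_n).
  by rewrite (cvg_shiftn 1 (fun n => iter n A f 0 : R[i]^o)); exact: is_cvg_iter.
by apply/funext => n; rewrite /= addn1 iterSr.
Qed.

Lemma limit_value_iter f n : Lip f -> limit_value (iter n A f) = limit_value f.
Proof.
move=> Lf; elim: n => [//|n IH]; rewrite iterS limit_value_A//; exact: Lip_iter.
Qed.

(** The limit value of [iter n A f] is still 0, and a function stays within its Lipschitz constant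
    of its limit value. So on the kernel of m the sup norm decays as fast as the seminorm. *)
Lemma iter_decay f K n : Lip f -> 0 <= K -> lipschitz_on01 f K ->
  limit_value f = 0 -> bounded_on01 (iter n A f) (rho ^+ n * K).
Proof.
move=> Lf K0 fK f0 x x01.
rewrite -modulusN -[- _]add0r -f0 -(limit_value_iter n Lf).
apply: limit_value_dist => //; first exact: Lip_iter.
  by rewrite mulr_ge0 ?exprn_ge0.
exact: iter_contracts.
Qed.

Lemma modulus_gt_neq0 z : rho < modulus z -> z != 0.
Proof. by move=> rz; rewrite -modulus_eq0 gt_eqF// (le_lt_trans _ rz). Qed.

Lemma ratio_on01 z : rho < modulus z -> 0 <= rho / modulus z < 1.
Proof.
move=> rz; rewrite divr_ge0 ?modulus_ge0//= ltr_pdivrMr ?mul1r//.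
exact: le_lt_trans rz.
Qed.

(** * Neumann series of A - z on the kernel of the limit functional *)

Section Neumann.
Variables (z : R[i]) (g : cfun R) (K : R).
Hypothesis rho_z : rho < modulus z.
Hypothesis Lg : Lip g.
Hypothesis K_ge0 : 0 <= K.
Hypothesis gK : lipschitz_on01 g K.
Hypothesis g0 : limit_value g = 0.

Let q := rho / modulus z.
Let q01 : 0 <= q < 1. Proof. exact: ratio_on01. Qed.
Let z_neq0 : z != 0. Proof. exact: modulus_gt_neq0. Qed.
Let mz_gt0 : 0 < modulus z. Proof. exact: le_lt_trans rho_z. Qed.

(** Terms of the expansion of (A - z)^-1 in powers of 1/z. By [iter_decay] they decay with ratio rho
    / |z|, so the series also converges for rho < |z| <= 1. *)
Definition neumann_term k : cfun R := - z^-1 ^+ k.+1 *: iter k A g.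

Definition neumann_sum : cfun R :=
  fun x => limn (fun n => \sum_(0 <= k < n) neumann_term k x).

Let C := K / modulus z.
Let C_ge0 : 0 <= C. Proof. by rewrite divr_ge0// ltW. Qed.

Lemma modulus_neumann_coef k : modulus (- z^-1 ^+ k.+1) * (rho ^+ k * K) = C * q ^+ k.
Proof.
by rewrite modulusN modulusX modulusV exprS /C /q expr_div_n exprVn; ring.
Qed.

Lemma neumann_term_bounded k x : modulus (neumann_term k x) <= C * q ^+ k.
Proof.
rewrite /neumann_term cfunZE modulusM.
have [x01|x01] := boolP (0 <= x < 1); last first.
  rewrite (Lip_supported (Lip_iter k Lg))// modulus0 mulr0.
  by case/andP: q01 => q0 _; rewrite mulr_ge0 ?exprn_ge0.
rewrite -modulus_neumann_coef ler_wpM2l ?modulus_ge0//.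
exact: iter_decay.
Qed.

Lemma neumann_term_lipschitz k : lipschitz_on01 (neumann_term k) (C * q ^+ k).
Proof.
move=> x y x01 y01; rewrite /neumann_term !cfunZE -mulrBr modulusM.
rewrite -modulus_neumann_coef -mulrA ler_wpM2l ?modulus_ge0//.
exact: (iter_contracts k Lg K_ge0 gK).
Qed.

Lemma is_cvg_neumann x : cvgn (fun n => \sum_(0 <= k < n) neumann_term k x : R[i]^o).
Proof.
apply: (is_cvg_series_dominated (b := fun k => C * q ^+ k)
  (B := C * q ^+ 0 / (1 - q))) => [n _|m]; first exact: neumann_term_bounded.
exact: geometric_partial_sum_le.
Qed.

Lemma neumann_tail n x :
  modulus (neumann_sum x - \sum_(0 <= k < n) neumann_term k x) <=
  C / (1 - q) * q ^+ n.
Proof.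
have -> : neumann_sum x - \sum_(0 <= k < n) neumann_term k x =
    limn ((fun m => \sum_(0 <= k < m) neumann_term k x : R[i]^o) -
          (fun _ => \sum_(0 <= k < n) neumann_term k x : R[i]^o)).
  by rewrite (limB (@is_cvg_neumann x) (is_cvg_cst _)) lim_cst.
apply: modulus_limn_le.
  exact: is_cvgB (@is_cvg_neumann x) (is_cvg_cst _).
exists n => // m /= nm.
have -> : ((fun m => \sum_(0 <= k < m) neumann_term k x : R[i]^o) -
          (fun _ => \sum_(0 <= k < n) neumann_term k x : R[i]^o)) m =
     \sum_(n <= k < m) neumann_term k x.
  transitivity (\sum_(0 <= k < m) neumann_term k x - \sum_(0 <= k < n) neumann_term k x); first by [].
  by rewrite (big_cat_nat (n := n))//= addrAC subrr add0r.
rewrite (le_trans (ler_modulus_sum _ _ _))//.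
rewrite mulrAC (le_trans _ (geometric_partial_sum_le n m C_ge0 q01))//.
by apply: ler_sum => k _; exact: neumann_term_bounded.
Qed.

Lemma neumann_sum_bounded : bounded_on01 neumann_sum (C / (1 - q)).
Proof.
by move=> x _; have := neumann_tail 0 x; rewrite big_geq// subr0 mulr1.
Qed.

Lemma neumann_sum_lipschitz : lipschitz_on01 neumann_sum (C / (1 - q)).
Proof.
move=> x y x01 y01.
have -> : neumann_sum x - neumann_sum y =
    limn (fun m => \sum_(0 <= k < m) (neumann_term k x - neumann_term k y) : R[i]^o).
  rewrite /neumann_sum -(limB (@is_cvg_neumann x) (@is_cvg_neumann y)).
  by congr (limn _); apply/funext => m; rewrite sumrB.
apply: (modulus_limn_series_le (b := fun k => C * q ^+ k * `|x - y|)) => [k _|m].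
  exact: neumann_term_lipschitz.
rewrite -mulr_suml ler_wpM2r//.
by have := geometric_partial_sum_le 0 m C_ge0 q01; rewrite mulr1.
Qed.

Lemma neumann_sum_supported : supported neumann_sum.
Proof.
move=> x xN; rewrite /neumann_sum (_ : (fun n => _) = fun _ => 0 : R[i]^o).
  exact: lim_cst.
apply/funext => n; rewrite big1// => k _.
by rewrite /neumann_term cfunZE (Lip_supported (Lip_iter k Lg))// mulr0.
Qed.

Lemma Lip_neumann_sum : Lip neumann_sum.
Proof.
exact: LipI neumann_sum_supported neumann_sum_bounded neumann_sum_lipschitz.
Qed.

Let S n : cfun R := fun x => \sum_(0 <= k < n) neumann_term k x.

(** Telescoping: A - z maps the partial sum to g, up to a remainder of size (rho / |z|)^n. *)
Lemma neumann_partial n : Lip (S n) /\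
  A (S n) = z *: S n + g - (z^-1 ^+ n) *: iter n A g.
Proof.
elim: n => [|n [LS AS]].
  have -> : S 0 = 0 by apply/funext => x; rewrite /S big_geq.
  split; first exact: Lip0.
  by rewrite A0 scaler0 add0r expr0 scale1r subrr.
have SS : S n.+1 = - z^-1 ^+ n.+1 *: iter n A g + S n.
  by apply/funext => x; rewrite /S big_nat_recr//= addrC.
split; first by rewrite SS; apply: Lip_comb => //; exact: Lip_iter.
rewrite SS A_linear//; last exact: Lip_iter.
rewrite AS -iterS; apply/funext => x.
rewrite !(cfunDE, cfunNE, cfunZE) exprS; set w := z^-1 ^+ n.
by field.
Qed.

(** A is not assumed to commute with pointwise limits. Instead, the sum is compared with its n-th
    partial sum: the tail is bounded by D q^n, and A preserves this sup bound. *)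
Lemma shift_neumann_sum : shift_op A z neumann_sum = g.
Proof.
apply/funext => x.
have [x01|x01] := boolP (0 <= x < 1); last first.
  rewrite /shift_op cfunDE cfunNE cfunZE A_supported// neumann_sum_supported//.
  by rewrite mulr0 subr0 (Lip_supported Lg).
apply/eqP; rewrite -subr_eq0 -modulus_eq0 eq_le modulus_ge0 andbT.
pose D := C / (1 - q).
(* The three summands account for A applied to the tail, z times the tail, and the leftover z^-n A^n
   g of the partial sum. *)
apply: (@le0_geometric _ (D + modulus z * D + K) q) => // n.
have [LS AS] := neumann_partial n.
have LD : Lip (- 1 *: S n + neumann_sum) by apply: Lip_comb => //; exact: Lip_neumann_sum.
have tailB : bounded_on01 (- 1 *: S n + neumann_sum) (D * q ^+ n).
  by move=> t _; rewrite cfunDE cfunZE mulN1r addrC; exact: neumann_tail.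
have -> : shift_op A z neumann_sum x - g x =
    A (- 1 *: S n + neumann_sum) x - z * (- 1 *: S n + neumann_sum) x
      - (z^-1 ^+ n) * iter n A g x.
  rewrite A_linear//; last exact: Lip_neumann_sum.
  by rewrite AS /shift_op !(cfunDE, cfunNE, cfunZE); ring.
rewrite (le_trans (ler_modulusB _ _))// !mulrDl lerD//.
  rewrite (le_trans (ler_modulusB _ _))// lerD//; first exact: A_bounded tailB _ _.
  by rewrite modulusM -mulrA ler_wpM2l ?modulus_ge0 ?tailB.
rewrite modulusM modulusX modulusV mulrC.
apply: (le_trans (ler_wpM2r _ (iter_decay n Lg K_ge0 gK g0 x01))).
  by rewrite exprn_ge0// invr_ge0 ltW.
by rewrite /q expr_div_n exprVn mulrAC mulrC.
Qed.

End Neumann.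

(** * Resolvent, eigenvectors and spectrum outside the disk of radius rho *)

Lemma Lip_centered g : Lip g -> Lip (- limit_value g *: one + g).
Proof. by move=> Lg; apply: Lip_comb => //; exact: Lip_one. Qed.

Lemma centered_lipschitz g K : lipschitz_on01 g K ->
  lipschitz_on01 (- limit_value g *: one + g) K.
Proof.
move=> gK; have := lipschitz_on01_comb (- limit_value g) (@lipschitz_on01_one R) gK.
by rewrite mulr0 add0r.
Qed.

Lemma limit_value_centered g : Lip g -> limit_value (- limit_value g *: one + g) = 0.
Proof. by move=> Lg; rewrite limit_value_comb_one// addNr. Qed.

(** The value z = 1 is included: there it says that the range of A - 1 together with the constants
    is everything. Centering leaves the seminorm unchanged, so both bounds depend on K alone. *)
Lemma shift_onto_centered z g B K : rho < modulus z -> Lip g -> 0 <= K ->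
  bounded_on01 g B -> lipschitz_on01 g K ->
  exists f, [/\ Lip f, shift_op A z f = - limit_value g *: one + g,
    bounded_on01 f (K / (modulus z - rho)) &
    lipschitz_on01 f (K / (modulus z - rho))].
Proof.
move=> rz Lg K0 gB gK.
have Lc := Lip_centered Lg; have cK := centered_lipschitz gK.
have c0 := limit_value_centered Lg.
have CE : K / modulus z / (1 - rho / modulus z) = K / (modulus z - rho).
  field; rewrite subr_eq0 gt_eqF// gt_eqF//; exact: le_lt_trans rz.
exists (neumann_sum z (- limit_value g *: one + g)); split.
- exact: Lip_neumann_sum cK c0.
- exact: shift_neumann_sum cK c0.
- by rewrite -CE; exact: neumann_sum_bounded.
- by rewrite -CE; exact: neumann_sum_lipschitz.
Qed.

Lemma shift_onto z g B K : rho < modulus z -> z != 1 -> Lip g -> 0 <= K ->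
  bounded_on01 g B -> lipschitz_on01 g K ->
  exists f, [/\ Lip f, shift_op A z f = g,
    bounded_on01 f ((B + K) / modulus (1 - z) + K / (modulus z - rho)) &
    lipschitz_on01 f (K / (modulus z - rho))].
Proof.
move=> rz z1 Lg K0 gB gK.
have [f [Lf Af fB fK]] := shift_onto_centered rz Lg K0 gB gK.
have z1' : 1 - z != 0 by rewrite subr_eq0 eq_sym.
(* A - z multiplies constants by 1 - z, so this constant restores the mean removed by centering. Its
   size is controlled by |m(g)| <= B + K. *)
set c : R[i] := limit_value g / (1 - z).
have Lcf : Lip (c *: one + f) by apply: Lip_comb => //; exact: Lip_one.
exists (c *: one + f); split => //.
- rewrite /shift_op A_linear ?A_one//; last exact: Lip_one.
  apply/funext => x; have /(congr1 (fun h => h x)) := Af.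
  rewrite /shift_op !(cfunDE, cfunNE, cfunZE) => /(canRL (subrK _)) ->.
  by rewrite /c; field.
- move=> x x01; have := bounded_on01_comb c (@bounded_on01_one R) fB x01.
  move=> /le_trans; apply; rewrite mulr1 lerD2r /c modulusM modulusV.
  rewrite ler_wpM2r ?invr_ge0 ?modulus_ge0// -(subrK (g x) (limit_value g)).
  rewrite (le_trans (ler_modulusD _ _))// addrC lerD ?gB//.
  exact: limit_value_dist.
- move=> x y x01 y01.
  have := lipschitz_on01_comb c (@lipschitz_on01_one R) fK x01 y01.
  by rewrite mulr0 add0r.
Qed.

(** Since A^n f = z^n f, the contraction gives |z|^n |f x - f 0| <= rho^n K for all n. *)
Lemma eigenvector_const z f : rho < modulus z -> Lip f -> A f = z *: f ->
  f = f 0 *: one.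
Proof.
move=> rz Lf Af; have [B [K [_ K0 _ fK _]]] := Lip_bounds Lf.
have Anf n : iter n A f = z ^+ n *: f.
  elim: n => [|n IH]; first by rewrite expr0 scale1r.
  rewrite iterS IH -[z ^+ n *: f]addr0 A_linear ?A0 ?addr0//; last exact: Lip0.
  by rewrite Af scalerA -exprSr.
have mz := le_lt_trans rho_ge0 rz.
apply/funext => x; rewrite cfunZE /one01.
case: ifPn => [x01|xN]; last by rewrite mulr0 (Lip_supported Lf).
rewrite mulr1; apply/eqP; rewrite -subr_eq0 -modulus_eq0 eq_le modulus_ge0 andbT.
apply: (le0_geometric (C := K) (ratio_on01 rz)) => n.
have := iter_contracts n Lf K0 fK x01 zero_on01.
rewrite Anf !cfunZE -mulrBr modulusM modulusX => H.
rewrite expr_div_n mulrA ler_pdivlMr ?exprn_gt0// mulrC (le_trans H)//.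
rewrite [K * _]mulrC ler_piMr ?mulr_ge0 ?exprn_ge0//.
by apply: dist_on01 => //; exact: zero_on01.
Qed.

Lemma eigenvector_eq0 z f : rho < modulus z -> z != 1 -> Lip f ->
  A f = z *: f -> f = 0.
Proof.
move=> rz z1 Lf Af; have fE := eigenvector_const rz Lf Af.
have : A (f 0 *: one) = z *: (f 0 *: one) by rewrite -fE.
rewrite -[X in A X]addr0 A_linear ?A0 ?A_one ?addr0; [|exact: Lip_one|exact: Lip0].
move=> /(congr1 (fun h => h 0)); rewrite !cfunZE one01E ?zero_on01// mulr1.
move=> /eqP; rewrite -subr_eq0 -{1}[f 0]mul1r -mulrBl mulf_eq0 subr_eq0 eq_sym (negbTE z1)/=.
by move=> /eqP f0; rewrite fE f0 scale0r.
Qed.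

Lemma bounded_operator_A : bounded_operator (@Lip R) (@lip_norm R) A.
Proof.
split=> [f|//|]; first exact: Lip_A.
exists 1 => f Lf; have [B [K [B0 K0 fB fK ->]]] := Lip_bounds Lf.
rewrite mul1e (le_trans (lip_norm_le (A_bounded Lf fB) (A_contracts Lf K0 fK)))//.
by rewrite lee_fin lerD2l ler_piMl// ltW.
Qed.

Lemma shift_op_linear z (c : R[i]) f g : Lip f -> Lip g ->
  shift_op A z (c *: f + g) = c *: shift_op A z f + shift_op A z g.
Proof.
move=> Lf Lg; rewrite /shift_op A_linear//; apply/funext => x.
by rewrite !(cfunDE, cfunNE, cfunZE); ring.
Qed.

Lemma Lip_shift z f : Lip f -> Lip (shift_op A z f).
Proof.
by move=> Lf; rewrite /shift_op -scaleNr addrC; apply: Lip_comb => //; exact: Lip_A.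
Qed.

Lemma shift_inj z f g : rho < modulus z -> z != 1 -> Lip f -> Lip g ->
  shift_op A z f = shift_op A z g -> f = g.
Proof.
move=> rz z1 Lf Lg fg.
have Ld : Lip (- 1 *: g + f) by exact: Lip_comb.
have d0 : shift_op A z (- 1 *: g + f) = 0.
  by rewrite shift_op_linear// fg scaleN1r addNr.
have /eqP := eigenvector_eq0 rz z1 Ld (subr0_eq d0).
by rewrite scaleN1r addrC subr_eq0 => /eqP.
Qed.

Lemma notin_spectrum z : rho < modulus z -> z != 1 ->
  ~ spectrum (@Lip R) (@lip_norm R) A z.
Proof.
move=> rz z1; apply.
(* The inverse is a chosen preimage. Uniqueness of preimages makes it linear and lets it inherit the
   bounds of [shift_onto]. *)
pose B g := xget 0 [set f | Lip f /\ shift_op A z f = g].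
have BP g : Lip g -> Lip (B g) /\ shift_op A z (B g) = g.
  move=> Lg; have [b [K [_ K0 gb gK _]]] := Lip_bounds Lg.
  have [f [Lf Af _ _]] := shift_onto rz z1 Lg K0 gb gK.
  have /(xgetPex 0) : [set h | Lip h /\ shift_op A z h = g] !=set0 by exists f.
  exact.
exists B; split; last first.
  move=> f Lf; split; last by case: (BP f Lf).
  have [L1 L2] := BP _ (Lip_shift z Lf).
  exact: (shift_inj rz z1 L1 Lf L2).
split=> [g /BP[]//|c f g Lf Lg|].
  have [L1 E1] := BP _ Lf; have [L2 E2] := BP _ Lg.
  have [L3 E3] := BP _ (Lip_comb c Lf Lg).
  apply: (shift_inj rz z1) => //; first exact: Lip_comb.
  by rewrite E3 shift_op_linear// E1 E2.
(* The first two terms come from the sup bound of [shift_onto], the last from its Lipschitz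
   bound. *)
pose M := (modulus (1 - z))^-1 + (modulus z - rho)^-1 + (modulus z - rho)^-1.
exists M => g Lg; have [b [K [b0 K0 gb gK ->]]] := Lip_bounds Lg.
have [f [Lf Af fb fK]] := shift_onto rz z1 Lg K0 gb gK.
have [L1 E1] := BP _ Lg.
have -> : B g = f by apply: (shift_inj rz z1) => //; rewrite E1.
rewrite (le_trans (lip_norm_le fb fK))// -EFinM lee_fin /M !mulrDl.
have i0 : 0 <= (modulus z - rho)^-1 by rewrite invr_ge0 subr_ge0 ltW.
have : 0 <= (modulus z - rho)^-1 * b by exact: mulr_ge0.
by set u := (modulus (1 - z))^-1; set v := (modulus z - rho)^-1; rewrite !mulrDr !(mulrC _ u) !(mulrC _ v); lra.
Qed.

Lemma A_one1 : A one = 1 *: one. Proof. by rewrite A_one scale1r. Qed.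

Lemma in_spectrum1 : spectrum (@Lip R) (@lip_norm R) A 1.
Proof.
move=> [B [_ BP]]; have [+ _] := BP _ (@Lip_one R).
have -> : shift_op A 1 one = shift_op A 1 0.
  by rewrite /shift_op A_one1 subrr A0 scaler0 subrr.
have [-> _] := BP _ (@Lip0 R); apply/eqP.
by rewrite eq_sym one01_neq0.
Qed.

Lemma has_dim_span_one (E : set (cfun R)) : E one ->
  (forall f, E f -> exists c : R[i], f = c *: one) -> has_dim E 1.
Proof.
move=> E1 Ec; exists (fun=> one); split => // [c|f /Ec[c ->]].
  rewrite big_ord1 => /(congr1 (fun h => h 0)); rewrite cfunZE one01E ?zero_on01//.
  by rewrite mulr1 => c0 i; rewrite (ord1 i).
by exists (fun=> c); rewrite big_ord1.
Qed.

Lemma kernel_shift1 f : Lip f -> A f = 1 *: f -> exists c : R[i], f = c *: one.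
Proof.
move=> Lf Af; exists (f 0); apply: (eigenvector_const _ Lf Af).
by rewrite modulus1.
Qed.

(** At z = 1 the constants are the kernel and also supplement the range; elsewhere A - z is
    bijective on [Lip] and both dimensions are 0. *)
Lemma fredholm_shift z : rho < modulus z -> fredholm (@Lip R) (shift_op A z).
Proof.
move=> rz; have [->|z1] := eqVneq z 1.
  split.
    exists 1; apply: has_dim_span_one.
      by split; [exact: Lip_one|rewrite /shift_op A_one1 subrr].
    by move=> f [Lf /subr0_eq]; exact: kernel_shift1.
  exists 1, (fun=> one); split; first by move=> _; exact: Lip_one.
  move=> f Lf; have [b [K [_ K0 fb fK _]]] := Lip_bounds Lf.
  have [|g [Lg Ag _ _]] := @shift_onto_centered 1 _ _ _ _ Lf K0 fb fK.
    by rewrite modulus1.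
  exists g, (fun=> limit_value f); split => //.
  by rewrite big_ord1 Ag scaleNr addrAC addNr add0r.
split.
  exists 0; exists (fun=> 0); split => [[]//|c _ []//|f [Lf /subr0_eq Af]].
  by exists (fun=> 0); rewrite big_ord0; exact: eigenvector_eq0 Af.
exists 0, (fun=> 0); split=> [[]//|f Lf].
have [b [K [_ K0 fb fK _]]] := Lip_bounds Lf.
have [g [Lg Ag _ _]] := shift_onto rz z1 Lf K0 fb fK.
by exists g, (fun=> 0); rewrite big_ord0 addr0.
Qed.

(** No Jordan block: if A f = f + c, then invariance of m gives m(f) = m(f) + c, so c = 0. *)
Lemma generalized_eigenvector1 f k : Lip f -> iter k (shift_op A 1) f = 0 ->
  exists c : R[i], f = c *: one.
Proof.
elim: k f => [f _ /= ->|k IH f Lf]; first by exists 0; rewrite scale0r.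
rewrite iterSr => /IH[|c]; first exact: Lip_shift.
rewrite /shift_op scale1r => /(canRL (subrK _)) Af.
have := limit_value_A Lf; rewrite Af limit_value_comb_one//.
move=> /eqP; rewrite -subr_eq0 addrK => /eqP c0.
by apply: kernel_shift1; rewrite // Af c0 scale0r add0r scale1r.
Qed.

Theorem lipschitz_contraction_spectral_gap :
  spectral_gap_at_1 (@Lip R) (@lip_norm R) A.
Proof.
split.
- exact: bounded_operator_A.
- apply: (@le_lt_trans _ _ rho%:E); last by rewrite lte_fin.
  apply: ge_ereal_sup => _ [z zess <-]; rewrite lee_fin leNgt; apply/negP.
  by move=> /fredholm_shift.
- split; first by exists one; split; [exact: Lip_one|exact: one01_neq0|exact: A_one1].
  apply: has_dim_span_one; last by move=> f [Lf [k]]; exact: generalized_eigenvector1.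
  split; first exact: Lip_one.
  by exists 1; rewrite /= /shift_op A_one1 subrr.
- move=> z [f [Lf f0 Af]] z1; apply/eqP; apply/negPn/negP => zn1.
  by move/eqP: f0; apply; apply: (eigenvector_eq0 _ zn1 Lf Af); rewrite z1.
- exists rho, (spectrum (@Lip R) (@lip_norm R) A `&` [set z | modulus z <= rho]).
  split => //.
  apply/seteqP; split=> z; last by move=> [->|[]//]; exact: in_spectrum1.
  move=> sz; have [->|z1] := eqVneq z 1; first by left.
  right; split => //=; rewrite leNgt; apply/negP => rz.
  exact: notin_spectrum sz.
Qed.

End LipschitzContraction.

(** * Oscillating branches *)

Section Oscillation.
Variable R : realType.
Implicit Types (s al c x y : R).

Lemma ler_dist_sin x y : `|sin x - sin y| <= `|x - y|.
Proof.
wlog xy : x y / x <= y => [H|].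
  by have [/H//|/ltW/H] := leP x y; rewrite distrC (distrC y).
have [//|t _ E] := @MVT_segment R sin cos x y xy.
  by apply: continuous_subspaceT => t; exact: continuous_sin.
by rewrite distrC E normrM (distrC x) ler_piMl// cos_max.
Qed.

Lemma ler_dist_cos x y : `|cos x - cos y| <= `|x - y|.
Proof.
rewrite -!sinDpihalf (le_trans (ler_dist_sin _ _))//.
by rewrite opprD addrACA subrr addr0.
Qed.

Lemma sin_pi_natmul k : sin (pi *+ k) = 0 :> R.
Proof.
elim: k => [|k IH]; first by rewrite mulr0n sin0.
by rewrite mulrSr sinDpi IH oppr0.
Qed.

Lemma cos_pi_natmul k : cos (pi *+ k) = (-1) ^+ k :> R.
Proof.
elim: k => [|k IH]; first by rewrite mulr0n cos0.
by rewrite mulrSr cosDpi IH exprS mulN1r.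
Qed.

Lemma pi_le4 : pi <= 4 :> R.
Proof. by have := @pihalf_lt2 R; lra. Qed.

(** Common form of v_n and w_n up to translation. As 1 + 2 cos^2 u = 2 + cos 2u and 1 + 2 sin^2 u =
    2 - cos 2u, they correspond to s = 1 and s = -1, and [dosc] is the derivative. *)
Definition osc s al c x := al * (2 * x + s * sin (c * x) / c).

Definition dosc s al c x := al * (2 + s * cos (c * x)).

Lemma is_derive_osc s al c x : c != 0 ->
  is_derive x 1 (osc s al c) (dosc s al c x).
Proof.
move=> c0; rewrite /osc; apply: is_derive_eq.
by rewrite /dosc /GRing.scale /=; field.
Qed.

Lemma continuous_osc s al c : c != 0 -> continuous (osc s al c).
Proof.
move=> c0 x; apply: differentiable_continuous; apply/derivable1_diffP.
by have := is_derive_osc s al x c0; case.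
Qed.

Lemma continuous_dosc s al c : continuous (dosc s al c).
Proof.
move=> x; apply: cvgMr; apply: cvgD; first exact: cvg_cst.
apply: cvgMr; apply: continuous_comp; last exact: continuous_cos.
by apply: cvgMr; exact: cvg_id.
Qed.

Lemma Rintegral_dosc s al c x : c != 0 -> 0 <= x ->
  \int[lebesgue_measure]_(t in `[0, x]) dosc s al c t = osc s al c x.
Proof.
move=> c0; rewrite le_eqVlt => /predU1P[<-|x0].
  by rewrite set_itv1 Rintegral_set1 /osc !(mulr0, sin0, mul0r, addr0).
rewrite /Rintegral (@continuous_FTC2 _ _ (osc s al c))//.
- by rewrite -EFinB/= [X in _ - X]/osc !(mulr0, sin0, mul0r, addr0) subr0.
- by apply: continuous_subspaceT; exact: continuous_dosc.
- split.
  + by move=> t _; have := is_derive_osc s al t c0; case.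
  + by apply: cvg_at_right_filter; exact: continuous_osc.
  + by apply: cvg_at_left_filter; exact: continuous_osc.
- move=> t _; rewrite derive1E.
  by have := is_derive_osc s al t c0; case.
Qed.

Lemma osc0 s al c : osc s al c 0 = 0.
Proof. by rewrite /osc !(mulr0, sin0, mul0r, addr0). Qed.

Lemma dosc_bounds s al c x : `|s| <= 1 -> 0 <= al ->
  al <= dosc s al c x <= 3 * al.
Proof.
move=> s1 al0; have : `|s * cos (c * x)| <= 1.
  by rewrite normrM mulr_ile1// cos_max.
rewrite ler_norml /dosc => /andP[? ?].
by rewrite (mulrC 3) ler_wpM2l ?ler_peMr//; lra.
Qed.

Lemma dosc_lipschitz s al c x y : `|s| <= 1 -> 0 <= al -> 0 <= c ->
  `|dosc s al c x - dosc s al c y| <= al * c * `|x - y|.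
Proof.
move=> s1 al0 c0; rewrite /dosc -mulrBr opprD addrACA subrr add0r -mulrBr.
rewrite !normrM (ger0_norm al0) -mulrA ler_wpM2l//.
rewrite -[X in _ <= X]mul1r ler_pM// (le_trans (ler_dist_cos _ _))//.
by rewrite -mulrBr normrM (ger0_norm c0).
Qed.

(** The factor 1/c cancels the frequency, so the sine contributes at most y - x on either side of 2
    (y - x). The bounds are uniform in c, however fast the derivative oscillates. *)
Lemma osc_increment s al c x y : `|s| <= 1 -> 0 <= al -> 0 < c -> x <= y ->
  al * (y - x) <= osc s al c y - osc s al c x <= 3 * al * (y - x).
Proof.
move=> s1 al0 c0 xy; rewrite /osc -mulrBr (mulrC 3) -[al * 3 * _]mulrA.
have : `|s * sin (c * y) / c - s * sin (c * x) / c| <= y - x.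
  rewrite -mulrBl -mulrBr !normrM normfV (gtr0_norm c0) ler_pdivrMr//.
  rewrite -[X in _ <= X]mul1r ler_pM// (le_trans (ler_dist_sin _ _))//.
  by rewrite -mulrBr normrM (gtr0_norm c0) ger0_norm ?subr_ge0// mulrC.
by rewrite ler_norml => /andP[? ?]; rewrite !ler_wpM2l//; lra.
Qed.

Lemma osc_lt s al c x y : `|s| <= 1 -> 0 < al -> 0 < c -> x < y ->
  osc s al c x < osc s al c y.
Proof.
move=> s1 al0 c0 xy; have /andP[H _] := osc_increment s1 (ltW al0) c0 (ltW xy).
by rewrite -subr_gt0 (lt_le_trans _ H)// mulr_gt0// subr_gt0.
Qed.

Lemma osc_ltE s al c x y : `|s| <= 1 -> 0 < al -> 0 < c ->
  (osc s al c x < osc s al c y) = (x < y).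
Proof.
move=> s1 al0 c0; apply/idP/idP => [|/(osc_lt s1 al0 c0)//].
apply: contraLR; rewrite -!leNgt le_eqVlt => /predU1P[->//|/(osc_lt s1 al0 c0)].
exact: ltW.
Qed.

Lemma osc_dist s al c x y : `|s| <= 1 -> 0 <= al -> 0 < c ->
  `|osc s al c x - osc s al c y| <= 3 * al * `|x - y|.
Proof.
move=> s1 al0 c0; wlog xy : x y / x <= y => [H|].
  by have [/H//|/ltW/H] := leP x y; rewrite distrC (distrC y).
have /andP[H1 H2] := osc_increment s1 al0 c0 xy.
rewrite distrC (distrC x) !ger0_norm ?subr_ge0//.
by rewrite -subr_ge0 (le_trans _ H1)// mulr_ge0// subr_ge0.
Qed.

Lemma osc_inj s al c : `|s| <= 1 -> 0 < al -> 0 < c -> injective (osc s al c).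
Proof.
move=> s1 al0 c0 x y xy; apply/eqP; rewrite eq_le !leNgt; apply/andP.
by split; apply/negP => /(osc_lt s1 al0 c0); rewrite xy ltxx.
Qed.

Definition frequency (n : nat) : R := 4 * pi * n%:R ^+ 4.

(** An integer multiple of pi: the sine vanishes at the right end 1, and the cosine alternates
    between 1 and -1 at the multiples of 1 / (4 n^4). *)
Lemma frequencyE n : frequency n = pi *+ (4 * n ^ 4).
Proof. by rewrite /frequency -[RHS]mulr_natr natrM natrX; ring. Qed.

Lemma frequency_gt0 n : (0 < n)%N -> 0 < frequency n.
Proof. by move=> n0; rewrite !mulr_gt0 ?pi_gt0 ?exprn_gt0 ?ltr0n. Qed.

Lemma osc1 s al n : osc s al (frequency n) 1 = 2 * al.
Proof.
by rewrite /osc !mulr1 frequencyE sin_pi_natmul mulr0 mul0r addr0; ring.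
Qed.

Lemma osc_surj s al n z : `|s| <= 1 -> 0 < al -> (0 < n)%N -> 0 <= z < 2 * al ->
  exists2 x, 0 <= x < 1 & osc s al (frequency n) x = z.
Proof.
move=> s1 al0 n0 /andP[z0 z2]; have c0 := frequency_gt0 n0.
have cont : {within `[0, 1], continuous (osc s al (frequency n))}.
  by apply: continuous_subspaceT; apply: continuous_osc; rewrite gt_eqF.
have [|x + xz] := @IVT _ _ _ _ z ler01 cont.
  by rewrite osc0 osc1 min_l ?max_r ?mulr_ge0 ?(ltW al0)// z0 ltW.
rewrite in_itv/= => /andP[x0 x1]; exists x => //; rewrite x0/= lt_neqAle x1 andbT.
by apply/eqP => x1E; move: z2; rewrite -xz x1E osc1 ltxx.
Qed.

End Oscillation.

(** * Indicators of intervals and their variation *)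

Section StepFunction.
Variable R : realType.

Definition step01 (p q : R) : cfun R := fun x => if p <= x < q then 1 else 0.

Lemma bounded_on01_step p q : bounded_on01 (step01 p q) 1.
Proof. by move=> x _; rewrite /step01; case: ifP; rewrite ?modulus1 ?modulus0. Qed.

Lemma supported_step p q : 0 <= p -> q <= 1 -> supported (step01 p q).
Proof.
move=> p0 q1 x xN; rewrite /step01 ifF//; apply: contraNF xN => /andP[px xq].
by rewrite (le_trans p0 px) (lt_le_trans xq q1).
Qed.

Lemma sup_norm_le (f : cfun R) B : bounded_on01 f B -> (sup_norm f <= B%:E)%E.
Proof.
by move=> fB; apply: ge_ereal_sup => _ [x + <-]; rewrite /= in_itv/= lee_fin => /fB.
Qed.

(* [step01 p q] is a difference of two nonincreasing functions with values in
   [0, 1]; [h] is their sum, and the increments of [- h] telescope. *)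
Lemma total_var_step p q : p <= q -> (total_var (step01 p q) <= 2%:E)%E.
Proof.
move=> pq; apply: ge_ereal_sup => _ [s [s_sorted _ ->]]; rewrite lee_fin.
pose h x : R := (x < p)%R%:R + (x < q)%R%:R.
have h_dist x y : x <= y ->
    modulus (step01 p q y - step01 p q x) <= - h y - - h x.
  move=> xy; rewrite /step01 /h.
  case: (ltP x p) => xp; case: (ltP x q) => xq; case: (ltP y p) => yp;
    case: (ltP y q) => yq; rewrite ?subrr ?subr0 ?sub0r ?modulusN ?modulus0 ?modulus1/=;
    lra.
apply: (@le_trans _ _ (\sum_(0 <= i < (size s).-1) (- h s`_i.+1 - - h s`_i))).
  rewrite big_mkord; apply: ler_sum => i _; apply/h_dist/ltW.
  by have /(sortedP 0) := s_sorted; apply; have := ltn_ord i; rewrite -ltn_predRL.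
rewrite telescope_sumr// /h.
by case: (_ < p); case: (_ < q); case: (_ < p); case: (_ < q); rewrite /=; lra.
Qed.

Lemma bv_norm_ge0 (f : cfun R) : (0 <= bv_norm f)%E.
Proof.
apply: adde_ge0.
  apply: (@le_trans _ _ (modulus (f 0))%:E); first by rewrite lee_fin modulus_ge0.
  by apply: ereal_sup_ubound; exists 0; rewrite //= in_itv/= lexx ltr01.
by apply: ereal_sup_ubound; exists [::]; rewrite big_ord0.
Qed.

End StepFunction.

(** * The transfer operator and the map T *)

Section Branches.
Variable R : realType.
Variables (a : nat -> R) (N : nat).
Hypothesis a_gt0 : forall n, (0 < n)%N -> 0 < a n.
Hypothesis cvg_a : cvgn (fun m => \sum_(1 <= k < m) a k).
Hypothesis total_lt1 : total_length a < 1.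
Hypothesis N_gt0 : (0 < N)%N.
Implicit Types (n m : nat) (x y : R).

Local Notation c n := (@frequency R n).
Local Notation total := (total_length a).
Local Notation d := (daff a N).

Let abs1 : `|1 : R| <= 1. Proof. by rewrite normr1. Qed.
Let absN1 : `|- 1 : R| <= 1. Proof. by rewrite normrN normr1. Qed.

Lemma dvE n x : dv a n x = dosc 1 (a n) (c n) x.
Proof.
rewrite /dv /dosc /frequency (_ : 4 * pi * _ * _ = (2 * pi * n%:R ^+ 4 * x) *+ 2).
  by rewrite cos_mulr2n mul1r -mulr_natl; congr (_ * _); ring.
by rewrite -mulr_natl; ring.
Qed.

Lemma dwE n x : dw a n x = dosc (- 1) (a n) (c n) x.
Proof.
rewrite /dw sin2cos2 /dosc /frequency.
rewrite (_ : 4 * pi * _ * _ = (2 * pi * n%:R ^+ 4 * x) *+ 2).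
  by rewrite cos_mulr2n -mulr_natl; congr (_ * _); ring.
by rewrite -mulr_natl; ring.
Qed.

Lemma dv_dw n x : dv a n x + dw a n x = 4 * a n.
Proof. by rewrite dvE dwE /dosc; ring. Qed.

Lemma vE n x : (0 < n)%N -> 0 <= x -> v a n x = left_end a n + osc 1 (a n) (c n) x.
Proof.
move=> n0 x0; rewrite /v (_ : dv a n = dosc 1 (a n) (c n)); last first.
  by apply/funext => t; rewrite dvE.
by rewrite Rintegral_dosc// gt_eqF// frequency_gt0.
Qed.

Lemma wE n x : (0 < n)%N -> 0 <= x ->
  w a n x = left_end a n + 2 * a n + osc (- 1) (a n) (c n) x.
Proof.
move=> n0 x0; rewrite /w (_ : dw a n = dosc (- 1) (a n) (c n)); last first.
  by apply/funext => t; rewrite dwE.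
by rewrite Rintegral_dosc// gt_eqF// frequency_gt0.
Qed.

Lemma dv_ge0 n x : (0 < n)%N -> 0 <= dv a n x.
Proof.
move=> /a_gt0/ltW a0; rewrite dvE.
by have /andP[+ _] := dosc_bounds (c n) x abs1 a0; apply: le_trans.
Qed.

Lemma dw_ge0 n x : (0 < n)%N -> 0 <= dw a n x.
Proof.
move=> /a_gt0/ltW a0; rewrite dwE.
by have /andP[+ _] := dosc_bounds (c n) x absN1 a0; apply: le_trans.
Qed.

Lemma left_end1 : left_end a 1 = 0.
Proof. by rewrite /left_end big_geq// mulr0. Qed.

Lemma left_endS n : (0 < n)%N -> left_end a n.+1 = left_end a n + 4 * a n.
Proof. by move=> n0; rewrite /left_end big_nat_recr//= mulrDr. Qed.

Lemma nondecreasing_left_end : nondecreasing_seq (left_end a).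
Proof.
have H : nondecreasing_seq (fun m => \sum_(1 <= k < m) a k).
  by apply: nondecreasing_series => k /a_gt0/ltW.
by move=> n m nm; rewrite ler_pM2l//; exact: H.
Qed.

Lemma left_end_ge0 n : 0 <= left_end a n.
Proof.
case: n => [|n]; first by rewrite /left_end big_geq// mulr0.
by rewrite -left_end1; exact: nondecreasing_left_end.
Qed.

Lemma left_end_lt n m : (0 < n < m)%N -> left_end a n + 4 * a n <= left_end a m.
Proof. by move=> /andP[n0 nm]; rewrite -left_endS//; exact: nondecreasing_left_end. Qed.

Lemma cvg_left_end : left_end a n @[n --> \oo] --> total.
Proof. by apply: cvgMr; exact: cvg_a. Qed.

Lemma left_end_le_total n : left_end a n <= total.
Proof.
rewrite -(cvg_lim _ cvg_left_end)//.
by apply: nondecreasing_cvgn_le nondecreasing_left_end _ _; exact: cvgP cvg_left_end.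
Qed.

Lemma left_end_add_le_total n : (0 < n)%N -> left_end a n + 4 * a n <= total.
Proof. by move=> n0; rewrite -left_endS// left_end_le_total. Qed.

Lemma total_ge0 : 0 <= total.
Proof. exact: le_trans (left_end_ge0 0) (left_end_le_total 0). Qed.

Lemma v_range n x : (0 < n)%N -> 0 <= x < 1 ->
  left_end a n <= v a n x < left_end a n + 2 * a n.
Proof.
move=> n0 /andP[x0 x1]; have c0 := frequency_gt0 R n0; have a0 := a_gt0 n0.
rewrite vE// lerDl ltrD2l -(osc1 1 (a n) n) osc_lt// andbT.
have /andP[+ _] := osc_increment abs1 (ltW a0) c0 x0.
by rewrite osc0 !subr0; apply: le_trans; rewrite mulr_ge0// ltW.
Qed.

Lemma w_range n x : (0 < n)%N -> 0 <= x < 1 ->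
  left_end a n + 2 * a n <= w a n x < left_end a n + 4 * a n.
Proof.
move=> n0 /andP[x0 x1]; have c0 := frequency_gt0 R n0; have a0 := a_gt0 n0.
rewrite wE// lerDl (_ : 4 * a n = 2 * a n + 2 * a n); last by ring.
rewrite addrA ltrD2l -(osc1 (- 1) (a n) n) osc_lt// andbT.
have /andP[+ _] := osc_increment absN1 (ltW a0) c0 x0.
by rewrite osc0 !subr0; apply: le_trans; rewrite mulr_ge0// ltW.
Qed.

Lemma v_on01 n x : (0 < n)%N -> 0 <= x < 1 -> 0 <= v a n x < 1.
Proof.
move=> n0 x01; have := v_range n0 x01; have := a_gt0 n0.
have := left_end_ge0 n; have := left_end_add_le_total n0; have := total_lt1.
by move=> *; apply/andP; split; lra.
Qed.

Lemma w_on01 n x : (0 < n)%N -> 0 <= x < 1 -> 0 <= w a n x < 1.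
Proof.
move=> n0 x01; have := w_range n0 x01; have := a_gt0 n0.
have := left_end_ge0 n; have := left_end_add_le_total n0; have := total_lt1.
by move=> *; apply/andP; split; lra.
Qed.

Lemma v_dist n x y : (0 < n)%N -> 0 <= x -> 0 <= y ->
  `|v a n x - v a n y| <= 3 * a n * `|x - y|.
Proof.
move=> n0 x0 y0; rewrite !vE// opprD addrACA subrr add0r.
exact: osc_dist abs1 (ltW (a_gt0 n0)) (frequency_gt0 R n0).
Qed.

Lemma w_dist n x y : (0 < n)%N -> 0 <= x -> 0 <= y ->
  `|w a n x - w a n y| <= 3 * a n * `|x - y|.
Proof.
move=> n0 x0 y0; rewrite !wE// opprD addrACA subrr add0r.
exact: osc_dist absN1 (ltW (a_gt0 n0)) (frequency_gt0 R n0).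
Qed.

Lemma v_w_dist n x : (0 < n)%N -> 0 <= x < 1 -> `|v a n x - w a n x| <= 4 * a n.
Proof.
move=> n0 x01; have := v_range n0 x01; have := w_range n0 x01.
by move=> *; rewrite ler_norml; lra.
Qed.

Lemma daffE : N%:R * d = 1 - total.
Proof. by rewrite /daff mulrC divfK// pnatr_eq0 -lt0n. Qed.

Lemma daff_gt0 : 0 < d.
Proof. by rewrite divr_gt0 ?subr_gt0 ?ltr0n. Qed.

Lemma daff_le : d <= N%:R^-1.
Proof.
by rewrite -[leRHS]mul1r ler_wpM2r ?invr_ge0 ?ler0n// gerBl total_ge0.
Qed.

Lemma aff_range k x : 0 <= x < 1 ->
  total + k%:R * d <= aff a N k x < total + k.+1%:R * d.
Proof.
move=> /andP[x0 x1]; rewrite /aff lerD2l ltrD2l ler_pM2r ?daff_gt0//.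
by rewrite ltr_pM2r ?daff_gt0// lerDl x0/= -natr1 ltrD2l.
Qed.

Lemma aff_on01 k x : (k < N)%N -> 0 <= x < 1 -> 0 <= aff a N k x < 1.
Proof.
move=> kN x01; have /andP[lo hi] := aff_range k x01; apply/andP; split.
  apply: le_trans lo; rewrite addr_ge0 ?total_ge0// mulr_ge0// ltW//.
  exact: daff_gt0.
apply: (lt_le_trans hi); rewrite -lerBrDl -daffE ler_pM2r ?daff_gt0//.
by rewrite ler_nat.
Qed.

Lemma aff_ge_total k x : 0 <= x < 1 -> total <= aff a N k x.
Proof.
move=> /(aff_range k)/andP[+ _]; apply: le_trans.
by rewrite lerDl mulr_ge0// ltW// daff_gt0.
Qed.

(** * Sup and Lipschitz bounds for the transfer operator *)

Definition transfer_term (f : cfun R) x n : R[i]^o :=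
  (dv a n x)%:C%C *: f (v a n x) + (dw a n x)%:C%C *: f (w a n x).

Lemma transferE f x : 0 <= x < 1 -> transfer a N f x =
  limn (fun m => \sum_(1 <= n < m) transfer_term f x n)
    + \sum_(k < N) d%:C%C * f (aff a N k x).
Proof. by rewrite /transfer => ->. Qed.

Lemma transfer_supported f : supported (transfer a N f).
Proof. by move=> x /negbTE; rewrite /transfer => ->. Qed.

Lemma modulus_transfer_term f B x n : bounded_on01 f B -> 0 <= x < 1 ->
  (0 < n)%N -> modulus (transfer_term f x n) <= 4 * a n * B.
Proof.
move=> fB x01 n0; rewrite (le_trans (ler_modulusD _ _))// !modulusM.
rewrite !modulus_real !ger0_norm ?dv_ge0 ?dw_ge0// -(dv_dw n x) mulrDl.
by rewrite lerD// ler_wpM2l ?dv_ge0 ?dw_ge0// fB// (v_on01, w_on01).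
Qed.

Lemma sum_a_le m B : 0 <= B -> \sum_(1 <= n < m) 4 * a n * B <= total * B.
Proof.
by move=> B0; rewrite -mulr_suml -mulr_sumr ler_wpM2r//; exact: left_end_le_total.
Qed.

Lemma bounded_on01_ge0 (f : cfun R) B : bounded_on01 f B -> 0 <= B.
Proof.
move=> fB; apply: (le_trans (modulus_ge0 (f 0))).
by rewrite fB// lexx ltr01.
Qed.

Lemma is_cvg_transfer f B x : bounded_on01 f B -> 0 <= x < 1 ->
  cvgn (fun m => \sum_(1 <= n < m) transfer_term f x n).
Proof.
move=> fB x01; apply: (is_cvg_series_dominated (b := fun n => 4 * a n * B)
    (B := total * B)) => [n n0|m]; first exact: modulus_transfer_term.
exact: sum_a_le (bounded_on01_ge0 fB).
Qed.

(** At every point the weights are nonnegative and add up to [total] + N d = 1. *)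
Lemma transfer_bounded f B : bounded_on01 f B -> bounded_on01 (transfer a N f) B.
Proof.
move=> fB x x01; rewrite transferE// (le_trans (ler_modulusD _ _))//.
rewrite -[leRHS]mul1r -(subrK total 1) (addrC (1 - total)) mulrDl lerD//.
  apply: (modulus_limn_series_le (b := fun n => 4 * a n * B)) => [n n0|m].
    exact: modulus_transfer_term.
  exact: sum_a_le (bounded_on01_ge0 fB).
rewrite (le_trans (ler_modulus_sum _ _ _))// -daffE -mulrA mulr_natl.
rewrite -[N in _ *+ N]card_ord -sumr_const; apply: ler_sum => k _.
rewrite modulusM modulus_real gtr0_norm ?daff_gt0//.
by rewrite ler_wpM2l ?fB ?aff_on01// ltW// daff_gt0.
Qed.

Lemma transfer_linear (z : R[i]) f g B B' :
  bounded_on01 f B -> bounded_on01 g B' ->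
  transfer a N (z *: f + g) = z *: transfer a N f + transfer a N g.
Proof.
move=> fB gB; apply/funext => x; rewrite cfunDE cfunZE.
have [x01|xN] := boolP (0 <= x < 1); last first.
  by rewrite !transfer_supported// mulr0 addr0.
rewrite !transferE//.
have cf := is_cvg_transfer fB x01; have cg := is_cvg_transfer gB x01.
have -> : (fun m => \sum_(1 <= n < m) transfer_term (z *: f + g) x n) =
    z \*: (fun m => \sum_(1 <= n < m) transfer_term f x n) +
    (fun m => \sum_(1 <= n < m) transfer_term g x n).
  apply/funext => m; transitivity (z * (\sum_(1 <= n < m) transfer_term f x n)
    + \sum_(1 <= n < m) transfer_term g x n); last by [].
  rewrite mulr_sumr -big_split/=; apply: eq_bigr => n _.
  by rewrite /transfer_term !cfunDE !cfunZE /GRing.scale/=; ring.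
have -> : \sum_(k < N) d%:C%C * (z *: f + g) (aff a N k x) =
    z * \sum_(k < N) d%:C%C * f (aff a N k x) + \sum_(k < N) d%:C%C * g (aff a N k x).
  rewrite mulr_sumr -big_split/=; apply: eq_bigr => k _.
  by rewrite !cfunDE !cfunZE; ring.
by rewrite (limD (is_cvgZl_tmp cf) cg) (limZl_tmp z cf) /GRing.scale/=; ring.
Qed.

Lemma transfer_one : transfer a N (@one01 R) = @one01 R.
Proof.
apply/funext => x; have [x01|xN] := boolP (0 <= x < 1); last first.
  by rewrite transfer_supported// /one01 (negbTE xN).
rewrite transferE// one01E//.
rewrite (limn_real (r := left_end a)); last exact: cvgP cvg_left_end.
  rewrite (cvg_lim _ cvg_left_end)//.
  rewrite (eq_bigr (fun=> d%:C%C)) => [|k _]; last first.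
    by rewrite one01E ?mulr1// aff_on01.
  by rewrite sumr_const card_ord -rmorphMn -rmorphD/= -mulr_natl daffE addrC subrK.
move=> m; rewrite /left_end mulr_sumr rmorph_sum/=.
apply: eq_big_nat => n /andP[n0 _].
rewrite /transfer_term !one01E ?v_on01 ?w_on01//.
by rewrite -(dv_dw n x) rmorphD/= /GRing.scale/= !mulr1.
Qed.

Section Lipschitz.
Variable C : R.
(** The term 12 a_n^2 is the total weight 4 a_n of a slot times the Lipschitz constant 3 a_n of its
    branches; 4 a_n^2 c_n is the Lipschitz constant a_n c_n of a weight times the length 4 a_n of
    the slot. *)
Hypothesis sum_le : forall m,
  \sum_(1 <= n < m) (12 * a n ^+ 2 + 4 * a n ^+ 2 * c n) <= C.

(* The two oscillating weights sum to [4 * a n], so their large variations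
   [+-(dv x - dv y)] only see [f (v y) - f (w y)], which is [O(a n)]. *)
Lemma transfer_term_lipschitz f K x y n : 0 <= K -> lipschitz_on01 f K ->
  0 <= x < 1 -> 0 <= y < 1 -> (0 < n)%N ->
  modulus (transfer_term f x n - transfer_term f y n) <=
  (12 * a n ^+ 2 + 4 * a n ^+ 2 * c n) * (K * `|x - y|).
Proof.
move=> K0 fK x01 y01 n0; have a0 := a_gt0 n0.
have [/andP[x0 _] /andP[y0 _]] := (x01, y01).
have -> : transfer_term f x n - transfer_term f y n =
    (dv a n x)%:C%C * (f (v a n x) - f (v a n y)) +
    (dw a n x)%:C%C * (f (w a n x) - f (w a n y)) +
    (dv a n x - dv a n y)%:C%C * (f (v a n y) - f (w a n y)).
  have dwB : dw a n x - dw a n y = - (dv a n x - dv a n y).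
    have := dv_dw n x; have := dv_dw n y; lra.
  have dwE' : (dw a n x)%:C%C = (dw a n y)%:C%C - (dv a n x - dv a n y)%:C%C :> R[i].
    by rewrite -rmorphB; congr (_%:C)%C; move: dwB; lra.
  by rewrite /transfer_term /GRing.scale/= dwE' rmorphB/=; ring.
have Kv : modulus (f (v a n x) - f (v a n y)) <= K * (3 * a n * `|x - y|).
  by rewrite (le_trans (fK _ _ _ _)) ?v_on01// ler_wpM2l// v_dist.
have Kw : modulus (f (w a n x) - f (w a n y)) <= K * (3 * a n * `|x - y|).
  by rewrite (le_trans (fK _ _ _ _)) ?w_on01// ler_wpM2l// w_dist.
have Kvw : modulus (f (v a n y) - f (w a n y)) <= K * (4 * a n).
  by rewrite (le_trans (fK _ _ _ _)) ?w_on01 ?v_on01// ler_wpM2l// v_w_dist.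
have -> : (12 * a n ^+ 2 + 4 * a n ^+ 2 * c n) * (K * `|x - y|) =
    (dv a n x * (K * (3 * a n * `|x - y|)) + dw a n x * (K * (3 * a n * `|x - y|)))
    + a n * c n * `|x - y| * (K * (4 * a n)).
  by rewrite -mulrDl dv_dw; ring.
rewrite (le_trans (ler_modulusD _ _))// lerD//.
  rewrite (le_trans (ler_modulusD _ _))// !modulusM !modulus_real.
  rewrite (ger0_norm (dv_ge0 _ _))// (ger0_norm (dw_ge0 _ _))//.
  by rewrite lerD// ler_wpM2l ?dv_ge0 ?dw_ge0.
rewrite modulusM modulus_real ler_pM// ?modulus_ge0//.
by rewrite !dvE; exact: dosc_lipschitz abs1 (ltW a0) (ltW (frequency_gt0 R n0)).
Qed.

Lemma transfer_lipschitz f K : Lip f -> 0 <= K -> lipschitz_on01 f K ->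
  lipschitz_on01 (transfer a N f) ((C + N%:R^-1) * K).
Proof.
move=> Lf K0 fK x y x01 y01; have [B [_ [_ _ fB _ _]]] := Lip_bounds Lf.
have cx := is_cvg_transfer fB x01; have cy := is_cvg_transfer fB y01.
rewrite !transferE//.
have -> : forall s s' t t' : R[i], s + t - (s' + t') = (s - s') + (t - t').
  by move=> *; ring.
rewrite -(limB cx cy) -sumrB mulrDl mulrDl -!mulrA.
rewrite (le_trans (ler_modulusD _ _))// lerD//.
  have -> : (fun m => \sum_(1 <= n < m) transfer_term f x n) -
      (fun m => \sum_(1 <= n < m) transfer_term f y n) =
      (fun m => \sum_(1 <= n < m) (transfer_term f x n - transfer_term f y n)).
    by apply/funext => m; rewrite sumrB.
  apply: (modulus_limn_series_le (b := fun n =>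
    (12 * a n ^+ 2 + 4 * a n ^+ 2 * c n) * (K * `|x - y|))) => [n n0|m].
    exact: transfer_term_lipschitz.
  by rewrite -mulr_suml ler_wpM2r// mulr_ge0.
rewrite (le_trans (ler_modulus_sum _ _ _))//.
have dN := daff_le; have d0 := ltW daff_gt0.
have Nd1 : N%:R * d <= 1 by rewrite daffE gerBl total_ge0.
(* Each affine branch has weight d and contracts by d; N d^2 <= 1/N follows from N d <= 1 and d <=
   1/N. *)
apply: (@le_trans _ _ (\sum_(k < N) d * (d * (K * `|x - y|)))).
  apply: ler_sum => k _; rewrite -mulrBr modulusM modulus_real ger0_norm//.
  rewrite ler_wpM2l// (le_trans (fK _ _ _ _)) ?aff_on01//.
  rewrite /aff opprD addrACA subrr add0r -mulrBl opprD addrACA subrr add0r.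
  by rewrite normrM (ger0_norm d0); nra.
have KX : 0 <= K * `|x - y| by rewrite mulr_ge0.
rewrite sumr_const card_ord -[leLHS]mulr_natl (mulrA N%:R) (mulrA (N%:R * d)) ler_wpM2r//.
by rewrite -[leRHS]mul1r ler_pM// mulr_ge0.
Qed.

End Lipschitz.

(** * Unboundedness on functions of bounded variation *)

Lemma transfer_term_step n k x : (0 < n)%N -> (0 < k)%N -> k != n -> 0 <= x < 1 ->
  transfer_term (step01 (left_end a n) (left_end a n + 2 * a n)) x k = 0.
Proof.
move=> n0 k0 kn x01; rewrite /transfer_term /step01.
have := v_range k0 x01; have := w_range k0 x01.
have an := a_gt0 n0; have ak := a_gt0 k0.
have := kn; rewrite neq_ltn => /orP[kn'|nk] vk wk.
  have := @left_end_lt k n; rewrite k0 kn' => /(_ isT) H.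
  by rewrite !ifF ?scaler0 ?addr0//; apply/negbTE/negP; lra.
have := @left_end_lt n k; rewrite n0 nk => /(_ isT) H.
by rewrite !ifF ?scaler0 ?addr0//; apply/negbTE/negP; lra.
Qed.

Lemma transfer_step n x : (0 < n)%N -> 0 <= x < 1 ->
  transfer a N (step01 (left_end a n) (left_end a n + 2 * a n)) x =
  (dv a n x)%:C%C.
Proof.
move=> n0 x01; rewrite transferE// [X in _ + X]big1 => [|k _]; last first.
  have := aff_ge_total k x01; have := left_end_add_le_total n0.
  have := a_gt0 n0 => ? ? ?.
  by rewrite /step01 ifF ?mulr0//; apply/negbTE/negP; lra.
rewrite addr0; apply/cvg_lim => //.
apply: cvg_near_cst; exists n.+1 => // m /= nm.
rewrite (bigD1_seq n) ?mem_index_iota ?iota_uniq ?n0//= big_nat_cond big1.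
  rewrite addr0 /transfer_term /step01 v_range// ifF.
    by rewrite scaler0 addr0 /GRing.scale/= mulr1.
  by have := w_range n0 x01 => ?; apply/negbTE/negP; lra.
by move=> k /andP[/andP[k0 _] kn]; exact: transfer_term_step.
Qed.

(** Sampling at j / (4 n^4) makes the cosine in v_n' equal to (-1)^j, so consecutive values differ
    by 2 a_n. The 4 n^4 sample points in [0, 1) leave out 1, hence one increment fewer. *)
Lemma total_var_transfer_step n : (0 < n)%N ->
  (((4 * n ^ 4).-1%:R * (2 * a n))%:E <=
   total_var (transfer a N (step01 (left_end a n) (left_end a n + 2 * a n))))%E.
Proof.
move=> n0; apply: ereal_sup_ubound.
set k := (4 * n ^ 4)%N; have k0 : (0 < k)%N by rewrite muln_gt0 expn_gt0 n0.
have kR : 0 < k%:R :> R by rewrite ltr0n.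
pose X j : R := j%:R / k%:R.
have X01 j : (j < k)%N -> 0 <= X j < 1.
  by move=> jk; rewrite divr_ge0//= ltr_pdivrMr// mul1r ltr_nat.
exists (mkseq X k); split.
- apply/(sortedP 0) => i; rewrite size_mkseq => ik.
  rewrite !nth_mkseq ?(ltnW ik)// ltr_pM2r ?invr_gt0// ltr_nat//.
- by apply/allP => _ /mapP[j + ->]; rewrite mem_iota => /andP[_ /X01].
- rewrite size_mkseq; congr EFin.
  rewrite (eq_bigr (fun=> 2 * a n)) => [|i _]; last first.
    have ik : (i.+1 < k)%N by have := ltn_ord i; rewrite -ltn_predRL.
    rewrite !nth_mkseq ?(ltnW ik)// !transfer_step ?X01 ?(ltnW ik)//.
    rewrite modulus_realB !dvE /dosc -mulrBr.
    have cX j : c n * X j = pi *+ j.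
      by rewrite /X frequencyE -/k -[in LHS]mulr_natr -[RHS]mulr_natr; field; rewrite gt_eqF.
    rewrite !cX !cos_pi_natmul exprS.
    have := normr_sign R i; have an := a_gt0 n0.
    rewrite normrM (gtr0_norm an) => E.
    have -> : 2 + 1 * (-1 * (-1) ^+ i) - (2 + 1 * (-1) ^+ i) = - 2 * (-1) ^+ i :> R by ring.
    by rewrite normrM E normrN ger0_norm// mulr1 mulrC.
  by rewrite sumr_const card_ord mulr_natl.
Qed.

Lemma transfer_unbounded_BV :
  (forall M, exists2 n, (0 < n)%N & M < (4 * n ^ 4).-1%:R * (2 * a n)) ->
  ~ bounded_operator (@BV R) (@bv_norm R) (transfer a N).
Proof.
move=> big [_ _ [M HM]].
(* The indicator has [BV] norm at most 3: sup norm at most 1 and variation at most 2. The absolute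
   value covers a negative M. *)
have [n n0 Mn] := big (3 * `|M|).
have an := a_gt0 n0; have tn := left_end_add_le_total n0; have := total_lt1 => t1.
set f := step01 (left_end a n) (left_end a n + 2 * a n).
have f3 : (bv_norm f <= 3%:E)%E.
  rewrite (_ : 3 = 1 + 2); last by ring.
  rewrite EFinD leeD//; first exact/sup_norm_le/bounded_on01_step.
  by apply: total_var_step; lra.
have BVf : BV f.
  split; last by rewrite (le_lt_trans f3)// ltry.
  by apply: supported_step; [exact: left_end_ge0|lra].
have := HM _ BVf; apply/negP; rewrite -ltNge.
apply: (@le_lt_trans _ _ (3 * `|M|)%:E).
  move: f3 (bv_norm_ge0 f); case: (bv_norm f) => [b| |]//.
  rewrite !lee_fin mulrC => b3 b0.
  rewrite (le_trans (ler_wpM2l b0 (ler_norm M)))// ler_wpM2r//.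
apply: (@lt_le_trans _ _ (total_var (transfer a N f))).
  by apply: lt_le_trans (total_var_transfer_step n0); rewrite lte_fin.
rewrite leeDr//; apply: (@le_trans _ _ (modulus (transfer a N f 0))%:E).
  by rewrite lee_fin modulus_ge0.
by apply: ereal_sup_ubound; exists 0; rewrite //= in_itv/= lexx ltr01.
Qed.

(** * The branches partition [0, 1) and T inverts them *)

Lemma v_lt n x y : (0 < n)%N -> 0 <= x -> 0 <= y -> (v a n x < v a n y) = (x < y).
Proof. by move=> n0 x0 y0; rewrite !vE// ltrD2l osc_ltE ?frequency_gt0 ?a_gt0. Qed.

Lemma w_lt n x y : (0 < n)%N -> 0 <= x -> 0 <= y -> (w a n x < w a n y) = (x < y).
Proof. by move=> n0 x0 y0; rewrite !wE// ltrD2l osc_ltE ?frequency_gt0 ?a_gt0. Qed.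

Lemma aff_lt k x y : (aff a N k x < aff a N k y) = (x < y).
Proof. by rewrite /aff ltrD2l ltr_pM2r ?daff_gt0// ltrD2l. Qed.

Lemma v_at1 n : (0 < n)%N -> v a n 1 = left_end a n + 2 * a n.
Proof. by move=> n0; rewrite vE// osc1. Qed.

Lemma w_at1 n : (0 < n)%N -> w a n 1 = left_end a n + 4 * a n.
Proof. by move=> n0; rewrite wE// osc1; ring. Qed.

Lemma v_surj n y : (0 < n)%N -> left_end a n <= y < left_end a n + 2 * a n ->
  exists2 x, 0 <= x < 1 & y = v a n x.
Proof.
move=> n0 yn; have [|x x01 xy] := @osc_surj R 1 (a n) n (y - left_end a n) abs1 (a_gt0 n0) n0.
  by apply/andP; split; lra.
by exists x; rewrite // vE ?xy ?(addrC (left_end a n)) ?subrK//; case/andP: x01.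
Qed.

Lemma w_surj n y : (0 < n)%N ->
  left_end a n + 2 * a n <= y < left_end a n + 4 * a n ->
  exists2 x, 0 <= x < 1 & y = w a n x.
Proof.
move=> n0 yn; have [|x x01 xy] := @osc_surj R (- 1) (a n) n
    (y - (left_end a n + 2 * a n)) absN1 (a_gt0 n0) n0.
  by apply/andP; split; lra.
exists x; rewrite // wE ?xy//; first by ring.
by case/andP: x01.
Qed.

Lemma aff_surj k y : total + k%:R * d <= y < total + k.+1%:R * d ->
  exists2 x, 0 <= x < 1 & y = aff a N k x.
Proof.
have d0 := daff_gt0; have dn0 : d != 0 by rewrite gt_eqF.
rewrite -natr1 mulrDl mul1r => /andP[lo hi].
exists ((y - total) / d - k%:R); last by rewrite /aff; field.
by rewrite subr_ge0 ler_pdivlMr// ltrBlDr ltr_pdivrMr// mulrDl mul1r; lra.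
Qed.

Lemma left_end_slot n m y : (0 < n)%N -> (0 < m)%N ->
  left_end a n <= y < left_end a n + 4 * a n ->
  left_end a m <= y < left_end a m + 4 * a m -> n = m.
Proof.
move=> n0 m0 yn ym; have [nm|mn|//] := ltngtP n m.
  by have := @left_end_lt n m; rewrite n0 nm => /(_ isT) H; exfalso; lra.
by have := @left_end_lt m n; rewrite m0 mn => /(_ isT) H; exfalso; lra.
Qed.

Lemma aff_slot k j y :
  total + k%:R * d <= y < total + k.+1%:R * d ->
  total + j%:R * d <= y < total + j.+1%:R * d -> k = j.
Proof.
have d0 := daff_gt0; move=> yk yj; have [kj|jk|//] := ltngtP k j.
  have : k.+1%:R * d <= j%:R * d by rewrite ler_pM2r// ler_nat.
  by move=> H; exfalso; lra.
have : j.+1%:R * d <= k%:R * d by rewrite ler_pM2r// ler_nat.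
by move=> H; exfalso; lra.
Qed.

Lemma v_slot n x : (0 < n)%N -> 0 <= x < 1 ->
  left_end a n <= v a n x < left_end a n + 4 * a n.
Proof. by move=> n0 x01; have := v_range n0 x01; have := a_gt0 n0; lra. Qed.

Lemma w_slot n x : (0 < n)%N -> 0 <= x < 1 ->
  left_end a n <= w a n x < left_end a n + 4 * a n.
Proof. by move=> n0 x01; have := w_range n0 x01; have := a_gt0 n0; lra. Qed.

Lemma on_branch_v n x x' : (0 < n)%N -> 0 <= x < 1 -> 0 <= x' < 1 ->
  on_branch a N (v a n x) x' -> x' = x.
Proof.
move=> n0 x01 x'01 [[m m0 [E|E]]|[k kN E]].
- have := v_slot m0 x'01; rewrite -E => /(left_end_slot n0 m0 (v_slot n0 x01)) nm.
  move: E; rewrite -nm; case/andP: x01 => x0 _; case/andP: x'01 => x'0 _.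
  rewrite !vE// => /addrI /osc_inj -> //; first exact: a_gt0.
  exact: frequency_gt0.
- have := w_slot m0 x'01; rewrite -E => /(left_end_slot n0 m0 (v_slot n0 x01)) nm.
  by move: E; rewrite -nm => E; have := v_range n0 x01; have := w_range n0 x'01; lra.
- have := aff_ge_total k x'01; have := v_slot n0 x01.
  by have := left_end_add_le_total n0; lra.
Qed.

Lemma on_branch_w n x x' : (0 < n)%N -> 0 <= x < 1 -> 0 <= x' < 1 ->
  on_branch a N (w a n x) x' -> x' = x.
Proof.
move=> n0 x01 x'01 [[m m0 [E|E]]|[k kN E]].
- have := v_slot m0 x'01; rewrite -E => /(left_end_slot n0 m0 (w_slot n0 x01)) nm.
  by move: E; rewrite -nm => E; have := w_range n0 x01; have := v_range n0 x'01; lra.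
- have := w_slot m0 x'01; rewrite -E => /(left_end_slot n0 m0 (w_slot n0 x01)) nm.
  move: E; rewrite -nm; case/andP: x01 => x0 _; case/andP: x'01 => x'0 _.
  rewrite !wE// => /addrI /osc_inj -> //; first exact: a_gt0.
  exact: frequency_gt0.
- have := aff_ge_total k x'01; have := w_slot n0 x01.
  by have := left_end_add_le_total n0; lra.
Qed.

Lemma on_branch_aff k x x' : 0 <= x < 1 -> 0 <= x' < 1 ->
  on_branch a N (aff a N k x) x' -> x' = x.
Proof.
move=> x01 x'01 [[m m0 [E|E]]|[j jN E]].
- have := aff_ge_total k x01; have := v_slot m0 x'01.
  by have := left_end_add_le_total m0; lra.
- have := aff_ge_total k x01; have := w_slot m0 x'01.
  by have := left_end_add_le_total m0; lra.
- have := aff_range j x'01; rewrite -E => /(aff_slot (aff_range k x01)) kj.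
  move: E; rewrite -kj /aff => /addrI /mulIf; rewrite gt_eqF ?daff_gt0// => /(_ isT).
  by move=> /addrI.
Qed.

Lemma T_unique y x : 0 <= x < 1 -> on_branch a N y x ->
  (forall x', 0 <= x' < 1 -> on_branch a N y x' -> x' = x) -> T a N y = x.
Proof.
move=> x01 yx uniq; have : 0 <= T a N y < 1 /\ on_branch a N y (T a N y).
  have : exists x', [set x' | 0 <= x' < 1 /\ on_branch a N y x'] x' by exists x.
  by move=> /(xgetPex 0).
by move=> [T01 yT]; exact: uniq.
Qed.

Lemma T_v n x : (0 < n)%N -> 0 <= x < 1 -> T a N (v a n x) = x.
Proof.
move=> n0 x01; apply: T_unique => //; first by left; exists n => //; left.
by move=> x' x'01; exact: on_branch_v.
Qed.

Lemma T_w n x : (0 < n)%N -> 0 <= x < 1 -> T a N (w a n x) = x.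
Proof.
move=> n0 x01; apply: T_unique => //; first by left; exists n => //; right.
by move=> x' x'01; exact: on_branch_w.
Qed.

Lemma T_aff k x : (k < N)%N -> 0 <= x < 1 -> T a N (aff a N k x) = x.
Proof.
move=> kN x01; apply: T_unique => //; first by right; exists k.
by move=> x' x'01; exact: on_branch_aff.
Qed.

(** Locates y among the endpoints, both of the slots I_n and of the N affine pieces. *)
Lemma consecutive_bracket (u : nat -> R) m y : u 0 <= y -> y < u m ->
  exists2 n, (n < m)%N & u n <= y < u n.+1.
Proof.
move=> u0; elim: m => [|m IH] um; first by move: um; rewrite ltNge u0.
have [/IH[n nm yn]|my] := ltP y (u m); first by exists n; rewrite // ltnW.
by exists m; rewrite // my um.
Qed.

Lemma on_branch_cover y : 0 <= y < 1 ->
  [\/ exists n x, [/\ (0 < n)%N, 0 <= x < 1 & y = v a n x],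
      exists n x, [/\ (0 < n)%N, 0 <= x < 1 & y = w a n x] |
      exists k x, [/\ (k < N)%N, 0 <= x < 1 & y = aff a N k x]].
Proof.
move=> /andP[y0 y1]; have [yt|ty] := ltP y total; last first.
  pose u k : R := total + k%:R * d.
  have [||k kN yk] := @consecutive_bracket u N y; rewrite /u.
  - by rewrite mul0r addr0.
  - by rewrite daffE addrC subrK.
  by have [x x01 yx] := aff_surj yk; constructor 3; exists k, x.
(* Otherwise y would be an upper bound of the left ends, hence of their limit [total]. *)
have [m my] : exists m, y < left_end a m.
  apply/not_existsP => ym; move: yt; apply/negP; rewrite -leNgt.
  rewrite -(cvg_lim _ cvg_left_end)//; apply: limr_le; first exact: cvgP cvg_left_end.
  by apply: nearW => m; rewrite leNgt; apply/negP/ym.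
(* The shift is there because slots are numbered from 1, with left end 0 for the first. *)
have [||k _ yk] := @consecutive_bracket (fun k => left_end a k.+1) m y.
- by rewrite left_end1.
- by rewrite (lt_le_trans my)// nondecreasing_left_end.
move: yk; rewrite /= (@left_endS k.+1)// => /andP[ly yr].
have [ymid|midy] := ltP y (left_end a k.+1 + 2 * a k.+1).
  have [|x x01 yx] := @v_surj k.+1 y isT; first by rewrite ly.
  by constructor 1; exists k.+1, x.
have [|x x01 yx] := @w_surj k.+1 y isT; first by rewrite midy.
by constructor 2; exists k.+1, x.
Qed.

(** * Invariance of Lebesgue measure *)

Local Notation leb := (@lebesgue_measure R).

(** For 0 <= t <= 1, the part of I_n that T sends into [0, t): both branches are increasing, so it
    is an initial segment of each half. *)
Definition slot_below t n : set R :=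
  `[left_end a n, v a n t[ `|` `[left_end a n + 2 * a n, w a n t[.

Definition aff_below t k : set R := `[total + k%:R * d, aff a N k t[.

Lemma v_at0 n : (0 < n)%N -> v a n 0 = left_end a n.
Proof. by move=> n0; rewrite vE// osc0 addr0. Qed.

Lemma w_at0 n : (0 < n)%N -> w a n 0 = left_end a n + 2 * a n.
Proof. by move=> n0; rewrite wE// osc0 addr0. Qed.

Section Below.
Variable t : R.
Hypothesis t_ge0 : 0 <= t.
Hypothesis t_le1 : t <= 1.

Lemma v_le_mid n : (0 < n)%N -> left_end a n <= v a n t <= left_end a n + 2 * a n.
Proof.
by move=> n0; rewrite -(v_at1 n0) -{1}(v_at0 n0) !leNgt !v_lt// -!leNgt t_ge0.
Qed.

Lemma w_le_right n : (0 < n)%N ->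
  left_end a n + 2 * a n <= w a n t <= left_end a n + 4 * a n.
Proof.
by move=> n0; rewrite -(w_at1 n0) -(w_at0 n0) !leNgt !w_lt// -!leNgt t_ge0.
Qed.

Lemma preimage_T_below : `[0, 1[ `&` T a N @^-1` `]-oo, t[ =
  (\bigcup_n slot_below t n.+1) `|` \big[setU/set0]_(k < N) aff_below t k.
Proof.
rewrite -(bigcup_mkord N (aff_below t)).
apply/seteqP; split=> y /=.
  rewrite !in_itv/= => -[y01 Ty].
  have [[n [x [n0 x01 yE]]]|[n [x [n0 x01 yE]]]|[k [x [kN x01 yE]]]] := on_branch_cover y01.
  - left; exists n.-1 => //; rewrite prednK//; left; rewrite /= in_itv/= yE.
    have /andP[-> _] := v_range n0 x01; rewrite v_lt//; last by case/andP: x01.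
    by rewrite yE T_v in Ty.
  - left; exists n.-1 => //; rewrite prednK//; right; rewrite /= in_itv/= yE.
    have /andP[-> _] := w_range n0 x01; rewrite w_lt//; last by case/andP: x01.
    by rewrite yE T_w in Ty.
  - right; exists k => //; rewrite /aff_below/= in_itv/= yE.
    have /andP[-> _] := aff_range k x01; rewrite aff_lt.
    by rewrite yE T_aff in Ty.
move=> [[n _ []]|[k kN]]; rewrite /aff_below /= !in_itv/= => /andP[ly yt].
- have /andP[_ hi] := v_le_mid (ltn0Sn n).
  have [|x x01 yE] := @v_surj n.+1 y isT; first by rewrite ly (lt_le_trans yt).
  rewrite yE v_on01// T_v//; split=> //.
  by move: yt; rewrite yE v_lt//; case/andP: x01.
- have /andP[_ hi] := w_le_right (ltn0Sn n).
  have [|x x01 yE] := @w_surj n.+1 y isT; first by rewrite ly (lt_le_trans yt).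
  rewrite yE w_on01// T_w//; split=> //.
  by move: yt; rewrite yE w_lt//; case/andP: x01.
- have [|x x01 yE] := @aff_surj k y.
    rewrite ly (lt_le_trans yt)// /aff lerD2l ler_pM2r ?daff_gt0//.
    by rewrite -natr1 lerD2l.
  rewrite yE aff_on01// T_aff//; split=> //.
  by move: yt; rewrite yE aff_lt.
Qed.

Lemma measurable_slot_below n : measurable (slot_below t n).
Proof. by apply: measurableU; exact: measurable_itv. Qed.

Lemma measurable_preimage_T_below :
  measurable (`[0, 1[ `&` T a N @^-1` `]-oo, t[).
Proof.
rewrite preimage_T_below; apply: measurableU.
  by apply: bigcupT_measurable => n; exact: measurable_slot_below.
by apply: bigsetU_measurable => k _; exact: measurable_itv.
Qed.

Lemma lebesgue_measure_itv_co (p q : R) : p <= q -> leb `[p, q[ = (q - p)%:E.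
Proof.
move=> pq; rewrite lebesgue_measure_itv/= lte_fin; case: ltP => [//|qp].
by rewrite (@le_anti _ _ p q) ?subrr// pq.
Qed.

(** The sine terms of the two lengths have opposite signs and cancel. *)
Lemma measure_slot_below n : (0 < n)%N ->
  leb (slot_below t n) = (4 * a n * t)%:E.
Proof.
move=> n0; have [/andP[v0 v1] /andP[w0 w1]] := (v_le_mid n0, w_le_right n0).
rewrite measureU/=; [|exact: measurable_itv|exact: measurable_itv|]; last first.
  apply/seteqP; split=> // y [/=]; rewrite !in_itv/= => yv yw.
  by move: v1; lra.
rewrite !lebesgue_measure_itv_co// -EFinD vE// wE// /osc; congr EFin.
by ring.
Qed.

Lemma slot_below_sub n y : (0 < n)%N -> slot_below t n y ->
  left_end a n <= y < left_end a n + 4 * a n.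
Proof.
move=> n0 []/=; rewrite in_itv/= => H; have := v_le_mid n0; have := w_le_right n0;
  have := a_gt0 n0; lra.
Qed.

Lemma measure_slots_below : leb (\bigcup_n slot_below t n.+1) = (total * t)%:E.
Proof.
rewrite measure_semi_bigcup.
- apply/cvg_lim => //.
  rewrite (_ : (fun n => _) = fun m => (left_end a m.+1 * t)%:E).
    apply: cvg_EFin; first exact: nearW.
    apply: cvgMl; rewrite (_ : (fun m => left_end a m.+1) = [sequence left_end a (m + 1)]_m).
      by rewrite (cvg_shiftn 1 (left_end a)); exact: cvg_left_end.
    by apply/funext => m; rewrite /= addn1.
  apply/funext => m; rewrite (eq_bigr (fun n => (4 * a n.+1 * t)%:E)) => [|n _].
    by rewrite sumEFin -mulr_suml -mulr_sumr /left_end big_add1.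
  exact: measure_slot_below.
- by move=> n; exact: measurable_slot_below.
- move=> n m _ _ [y [yn ym]].
  by have [] := left_end_slot (ltn0Sn n) (ltn0Sn m) (slot_below_sub (ltn0Sn n) yn) (slot_below_sub (ltn0Sn m) ym).
- by apply: bigcupT_measurable => n; exact: measurable_slot_below.
Qed.

Lemma aff_below_sub k y : aff_below t k y ->
  total + k%:R * d <= y < total + k.+1%:R * d.
Proof.
rewrite /aff_below /= in_itv/= => /andP[-> yt]; rewrite (lt_le_trans yt)//.
by rewrite /aff lerD2l ler_pM2r ?daff_gt0// -natr1 lerD2l.
Qed.

Lemma measure_affs_below :
  leb (\big[setU/set0]_(k < N) aff_below t k) = ((1 - total) * t)%:E.
Proof.
rewrite measure_bigsetU_ord; last 2 first.
- by move=> k; exact: measurable_itv.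
- move=> k j _ _ [y [yk yj]]; apply/val_inj.
  exact: aff_slot (aff_below_sub yk) (aff_below_sub yj).
rewrite (eq_bigr (fun=> (d * t)%:E)) => [|k _].
  rewrite sumEFin sumr_const card_ord -daffE -[in LHS]mulr_natl; congr EFin.
  by ring.
transitivity (leb `[total + k%:R * d, aff a N k t[); first by [].
rewrite lebesgue_measure_itv_co /aff; first by congr EFin; ring.
by rewrite lerD2l ler_pM2r ?daff_gt0// lerDl.
Qed.

Lemma measure_preimage_T_below :
  leb (`[0, 1[ `&` T a N @^-1` `]-oo, t[) = t%:E.
Proof.
rewrite preimage_T_below measureU/=.
- rewrite measure_slots_below measure_affs_below -EFinD; congr EFin.
  by ring.
- by apply: bigcupT_measurable => n; exact: measurable_slot_below.
- by apply: bigsetU_measurable => k _; exact: measurable_itv.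
- rewrite -(bigcup_mkord N (aff_below t)); apply/seteqP; split=> // y.
  move=> [[n _ /(slot_below_sub (ltn0Sn n)) yn] [k _ /aff_below_sub yk]].
  have := left_end_add_le_total (ltn0Sn n).
  have : 0 <= k%:R * d by rewrite mulr_ge0// ltW// daff_gt0.
  by lra.
Qed.

End Below.

Lemma T_on01 y : 0 <= y < 1 -> 0 <= T a N y < 1.
Proof.
by move=> /on_branch_cover[] [n [x [n0 x01 ->]]]; rewrite (T_v, T_w, T_aff).
Qed.

(** Here s is t clamped to [0, 1]. All rays are needed to generate the Borel sets, while the
    measures of preimages are computed for endpoints in [0, 1]. *)
Lemma preimage_T_ray t : exists s, [/\ 0 <= s <= 1,
  `[0, 1[ `&` T a N @^-1` `]-oo, t[ = (`[0, 1[ `&` T a N @^-1` `]-oo, s[) &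
  `]-oo, t[ `&` `[0, 1[ = (`[0, s[%classic : set R)].
Proof.
have [t0|t0] := leP t 0.
  exists 0; split; rewrite ?lexx ?ler01//; apply/seteqP; split=> y; rewrite /= !in_itv/=.
  - by move=> [/T_on01/andP[T0 _] Tt]; exfalso; lra.
  - by move=> [/T_on01/andP[T0 _] Tt]; exfalso; lra.
  - by move=> [yt /andP[y0 _]]; exfalso; lra.
  - by move=> /andP[? ?]; exfalso; lra.
have [t1|t1] := leP t 1.
  exists t; split => //; first by rewrite (ltW t0).
  apply/seteqP; split=> y; rewrite /= !in_itv/=.
    by move=> [-> /andP[-> _]].
  by move=> /andP[-> yt]; rewrite yt (lt_le_trans yt).
exists 1; split; rewrite ?lexx ?ler01//; apply/seteqP; split=> y; rewrite /= !in_itv/=.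
- by move=> [y01 _]; split=> //; have /andP[] := T_on01 y01.
- by move=> [y01 T1]; split=> //; exact: lt_trans t1.
- by move=> [].
- by move=> y01; split=> //; case/andP: y01 => _ /lt_trans; exact.
Qed.

Lemma measurable_T : measurable_fun `[(0 : R), 1[ (T a N).
Proof.
apply: (measurability _ (RGenInftyO.measurableE R)).
move=> _ [_ [t ->] <-]; have [s [/andP[s0 s1] -> _]] := preimage_T_ray t.
exact: measurable_preimage_T_below.
Qed.

Lemma T_preserves_lebesgue : preserves_lebesgue (T a N).
Proof.
split; first exact: measurable_T.
have mD : measurable (`[(0 : R), 1[%classic : set (measurableTypeR R)) by exact: measurable_itv.
(* A total measurable map, so that a pushforward can be formed; its value 0 outside [0, 1) is
   invisible to Lebesgue measure restricted to [0, 1). *)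
pose g : measurableTypeR R -> measurableTypeR R := T a N \_ `[(0 : R), 1[.
have mg : measurable_fun [set: measurableTypeR R] g.
  by apply/(measurable_restrictT _ mD); exact: measurable_T.
have gE A : g @^-1` A `&` `[(0 : R), 1[ = `[0, 1[ `&` T a N @^-1` A.
  by rewrite setIC; apply/seteqP; split=> y /= [y01]; rewrite /g patchE ifT ?inE.
have key A : measurable A ->
    pushforward (mrestr leb mD) g A = mrestr leb mD A.
  pose m2 : {measure set (measurableTypeR R) -> \bar R} := mrestr leb mD.
  pose m1 : {measure set (measurableTypeR R) -> \bar R} :=
    measure_function_pushforward__canonical__measure_function_Measure m2 mg.
  (* The rays are stable under intersection, generate the Borel sets and exhaust the line, so
     agreement of the two finite measures on rays suffices. *)
  move=> mA; apply: (@measure_unique _ R (measurableTypeR R) _ (fun k : nat => `]-oo, k%:R[%classic)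
    (RGenInftyO.measurableE R) _ _ _ m1 m2) => //=.
  - move=> _ _ [s ->] [t ->]; exists (Order.min s t).
    by apply/seteqP; split=> y; rewrite /= !in_itv/= lt_min => /andP.
  - by move=> k; exists k%:R.
  - apply/seteqP; split=> // y _; exists (Num.bound `|y|) => //=.
    by rewrite in_itv/= (le_lt_trans (ler_norm _))// archi_boundP.
  - move=> _ [t ->]; rewrite /pushforward /mrestr gE.
    have [s [/andP[s0 s1] -> ->]] := preimage_T_ray t.
    by rewrite measure_preimage_T_below// lebesgue_measure_itv_co// subr0.
  - move=> k; rewrite /pushforward /mrestr gE.
    have [s [/andP[s0 s1] -> _]] := preimage_T_ray k%:R.
    by rewrite measure_preimage_T_below// ltry.
move=> A mA A01; have := key A mA; rewrite /pushforward /mrestr gE => ->.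
by congr (leb _); apply/setIidl.
Qed.

End Branches.

(** * The sequence a_n = 1 / (100 n^3) *)

Section CubicDecay.
Variable R : realType.

Definition cubic (n : nat) : R := 1 / (100 * n%:R ^+ 3).

Lemma cubic_gt0 n : (0 < n)%N -> 0 < cubic n.
Proof. by move=> n0; rewrite divr_gt0// mulr_gt0// exprn_gt0// ltr0n. Qed.

Lemma sum_inv_square_le m : \sum_(1 <= n < m) (n%:R ^+ 2)^-1 <= 2 :> R.
Proof.
(* The bound 2 alone does not pass through the induction; the slack 1/(k+1) absorbs the next
   term. *)
suff H k : \sum_(1 <= n < k.+2) (n%:R ^+ 2)^-1 <= 2 - k.+1%:R^-1 :> R.
  case: m => [|[|m]]; [by rewrite big_geq ?ler0n..|apply: le_trans (H m) _].
  by rewrite gerBl invr_ge0 ler0n.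
elim: k => [|k IH]; first by rewrite big_nat1 expr1n invr1; lra.
rewrite big_nat_recr//= (le_trans (lerD IH (lexx _)))//.
have k0 : 0 < k.+1%:R :> R by rewrite ltr0n.
rewrite -[k.+2%:R]natr1; set x : R := k.+1%:R in k0 *.
have x1 : 0 < x + 1 by lra.
rewrite -subr_ge0.
have -> : 2 - (x + 1)^-1 - (2 - x^-1 + ((x + 1) ^+ 2)^-1) = (x * (x + 1) ^+ 2)^-1.
  by field; rewrite !gt_eqF.
by rewrite invr_ge0 mulr_ge0 ?exprn_ge0 ?ltW.
Qed.

Lemma natr_ge1 n : (0 < n)%N -> 1 <= n%:R :> R.
Proof. by move=> n0; rewrite ler1n. Qed.

Lemma cubic_le n : (0 < n)%N -> cubic n <= (n%:R ^+ 2)^-1 / 100.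
Proof.
move=> n0; have n1 := natr_ge1 n0; have n0' : 0 < n%:R :> R by lra.
rewrite /cubic div1r invfM mulrC ler_wpM2r ?invr_ge0//.
by rewrite lef_pV2 ?posrE ?exprn_gt0// ler_weXn2l.
Qed.

Lemma sum_cubic_le m : \sum_(1 <= n < m) cubic n <= 2 / 100.
Proof.
apply: (@le_trans _ _ (\sum_(1 <= n < m) (n%:R ^+ 2)^-1 / 100)).
  by rewrite !big_nat ler_sum// => n /andP[n0 _]; exact: cubic_le.
by rewrite -mulr_suml ler_wpM2r ?invr_ge0// sum_inv_square_le.
Qed.

Lemma is_cvg_sum_cubic : cvgn (fun m => \sum_(1 <= k < m) cubic k).
Proof.
apply: nondecreasing_is_cvgn.
  by apply: nondecreasing_series => k /cubic_gt0/ltW.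
by exists (2 / 100) => _ [m _ <-]; exact: sum_cubic_le.
Qed.

Lemma total_length_cubic_lt1 : total_length cubic < 1.
Proof.
have : limn (fun m => \sum_(1 <= k < m) cubic k) <= 2 / 100.
  by apply: limr_le; [exact: is_cvg_sum_cubic|apply: nearW => m; exact: sum_cubic_le].
by rewrite /total_length; lra.
Qed.

(** Each term equals n^-2 (12 n^-4 + 16 pi) / 10000. With pi <= 4 this is at most 76 n^-2 / 10000,
    hence at most n^-2 / 100, and the n^-2 sum to at most 2. *)
Lemma sum_distortion_cubic_le m : \sum_(1 <= n < m)
  (12 * cubic n ^+ 2 + 4 * cubic n ^+ 2 * @frequency R n) <= 1 / 50.
Proof.
apply: (@le_trans _ _ (\sum_(1 <= n < m) (n%:R ^+ 2)^-1 / 100)); last first.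
  rewrite -mulr_suml; have := sum_inv_square_le m; lra.
rewrite !big_nat ler_sum// => n /andP[n0 _].
have n1 := natr_ge1 n0; have n0' : 0 < n%:R :> R by lra.
rewrite /cubic /frequency; set k : R := n%:R in n1 n0' *.
have kn0 : k != 0 by rewrite gt_eqF.
have -> : 12 * (1 / (100 * k ^+ 3)) ^+ 2 + 4 * (1 / (100 * k ^+ 3)) ^+ 2 * (4 * pi * k ^+ 4)
    = (k ^+ 2)^-1 * ((12 * (k ^+ 4)^-1 + 16 * pi) / 10000).
  by field.
rewrite ler_wpM2l ?invr_ge0 ?exprn_ge0 ?ltW//.
have : (k ^+ 4)^-1 <= 1 by rewrite invf_le1 ?exprn_gt0// exprn_ege1.
have := pi_le4 R; lra.
Qed.

(** Bounding 4 n^4 - 1 below by 3 n^4 leaves 6 n / 100, so any n above 100 |M| works; the successor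
    in the witness makes it positive. *)
Lemma variation_cubic_unbounded (M : R) : exists2 n, (0 < n)%N &
  M < (4 * n ^ 4).-1%:R * (2 * cubic n).
Proof.
pose n := (Num.bound (100 * `|M|)).+1; exists n => //.
have nM : 100 * `|M| < n%:R.
  rewrite (@lt_trans _ _ (Num.bound (100 * `|M|))%:R)//; last by rewrite ltr_nat.
  by rewrite archi_boundP// mulr_ge0.
have n0 : 0 < n%:R :> R by rewrite ltr0n.
have big : 3 * n%:R ^+ 4 <= (4 * n ^ 4).-1%:R :> R.
  rewrite -natrX -natrM ler_nat -ltnS prednK ?muln_gt0 ?expn_gt0//.
  by rewrite ltn_pmul2r// expn_gt0.
have E : 3 * n%:R ^+ 4 * (2 * cubic n) = 6 * n%:R / 100.
  by rewrite /cubic; field; rewrite gt_eqF.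
apply: (@lt_le_trans _ _ (6 * n%:R / 100)).
  by have := ler_norm M; have := normr_ge0 M; lra.
by rewrite -E ler_wpM2r// mulr_ge0// ltW// cubic_gt0.
Qed.

End CubicDecay.

Theorem mainTheorem1 (R : realType) :
  let a : nat -> R := fun n => 1 / (100 * n%:R ^+ 3) in
  let N : nat := 4%N in
  [/\ preserves_lebesgue (T a N),
      spectral_gap_at_1 (@Lip R) (@lip_norm R) (transfer a N)
    & ~ bounded_operator (@BV R) (@bv_norm R) (transfer a N)].
Proof.
move=> a N.
have a0 : forall n, (0 < n)%N -> 0 < a n := @cubic_gt0 R.
have ca : cvgn (fun m => \sum_(1 <= k < m) a k) := @is_cvg_sum_cubic R.
have a1 : total_length a < 1 := total_length_cubic_lt1 R.
have N0 : (0 < N)%N by [].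
split.
- exact: T_preserves_lebesgue.
- apply: (@lipschitz_contraction_spectral_gap _ _ (1 / 50 + N%:R^-1)).
  + by rewrite addr_ge0// invr_ge0.
  + by rewrite /N; lra.
  + exact: transfer_supported.
  + move=> z f g Lf Lg; have [B [_ [_ _ fB _ _]]] := Lip_bounds Lf.
    have [B' [_ [_ _ gB _ _]]] := Lip_bounds Lg.
    exact: transfer_linear fB gB.
  + exact: transfer_one.
  + by move=> f B _; exact: transfer_bounded.
  + move=> f K; apply: transfer_lipschitz => //.
    exact: (@sum_distortion_cubic_le R).
- apply: transfer_unbounded_BV => //.
  exact: (@variation_cubic_unbounded R).
Qed.
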